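(* Let $k>0$. For $0\le r<1$ and $x,y\in[-\pi,\pi]$, the Poisson kernel $P_k(r,x,y)=\sum_{n\in\mathbb{Z}}\gamma_n^k\,r^{|n|+k}\,E_n^k(ix)\,E_n^k(-iy)$ is given by $$P_k(r,x,y)=\frac{k}{2\pi}(1-r^2)\,r^{k}\int_{-1}^{1}\frac{(1+u)(1-u^2)^{k-1}\,du}{\bigl(1-2r(\cos x\cos y+u\sin x\sin y)+r^2\bigr)^{k+1}}.$$
   Context: Fix $k>0$. The Cherednik operator of type $A_1$ is $T^k f(x)=f'(x)+2k\,\frac{f(x)-f(-x)}{1-e^{-2x}}-k f(x)$ for $f\in C^1(\mathbb{R})$. On $\mathbb{Z}$ define the partial order $j\triangleleft n$ iff either ($|j|<|n|$ and $|n|-|j|$ is a positive even integer) or ($|j|=|n|$ and $n<j$). Let $dm_k(x)=|\sin x|^{2k}dx$ on $[-\pi,\pi]$ and $(f,g)_k=\int_{-\pi}^{\pi}f(x)\overline{g(x)}\,dm_k(x)$. For $n\in\mathbb{Z}$, the non-symmetric Heckman–Opdam polynomial $E_n^k$ is the unique function of the form $E_n^k(z)=e^{nz}+\sum_{j\triangleleft n}c_{n,j}e^{jz}$ ($z\in\mathbb{C}$, finitely many $j$) such that $(E_n^k(i\cdot),e^{ij\cdot})_k=0$ for all $j\triangleleft n$. These satisfy $T^kE_n^k=n_kE_n^k$, where $n_k=n+k$ if $n>0$ and $n_k=n-k$ if $n\le 0$; also $E_0^k=1$, $E_1^k(x)=e^x$, the coefficients $c_{n,j}$ are real and nonnegative,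 and $\{x\mapsto E_n^k(ix)\}_{n\in\mathbb{Z}}$ is an orthogonal basis of $L^2([-\pi,\pi],dm_k)$. Write $\|E_n^k\|_{2,k}^2=\int_{-\pi}^{\pi}|E_n^k(ix)|^2dm_k(x)$ and $\gamma_n^k=\|E_n^k\|_{2,k}^{-2}$. *)

(* Defs.v *)
From Stdlib Require Import Reals ZArith Bool.
From Coquelicot Require Import Coquelicot.
Open Scope R_scope.

(* Real power x^a for x >= 0.  For x > 0 it is Rpower x a = exp (a ln x);
   for x = 0 we set it to 0, the correct value of 0^a for a > 0
   (Stdlib's Rpower 0 a would give 1).  It is only ever used with x > 0,
   or with x >= 0 and a > 0. *)
Definition rpow (x a : R) : R :=
  if Rle_dec x 0 then 0 else Rpower x a.

Definition cexpi (t : R) : C := (cos t, sin t).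

Definition tri (j n : Z) : bool :=
  (andb (Z.abs j <? Z.abs n)%Z (Z.even (Z.abs n - Z.abs j)))
  || (andb (Z.abs j =? Z.abs n)%Z (n <? j)%Z).

(* Coefficient of e^{jz} in  e^{nz} + sum_{j <| n} c j e^{jz}. *)
Definition Ecoef (c : Z -> C) (n j : Z) : C :=
  if Z.eq_dec j n then 1%C else if tri j n then c j else 0%C.

(* E(i t) = sum_{j = -|n|}^{|n|} Ecoef c n j e^{i j t}
   (every j <| n satisfies |j| <= |n|). *)
Definition Efun (c : Z -> C) (n : Z) (t : R) : C :=
  sum_n_m (fun m : nat =>
     let j := (Z.of_nat m - Z.abs n)%Z in
     Cmult (Ecoef c n j) (cexpi (IZR j * t)))
    0 (2 * Z.abs_nat n).

Definition wk (k x : R) : R := rpow (Rabs (sin x)) (2 * k).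

(* Defining property of the non-symmetric Heckman-Opdam polynomial E_n^k
   with coefficients c:  (E_n^k(i.), e^{ij.})_k = 0 for all j <| n. *)
Definition IsHO (k : R) (n : Z) (c : Z -> C) : Prop :=
  forall j : Z, tri j n = true ->
    RInt (V := C_R_CompleteNormedModule)
      (fun x => scal (wk k x) (Cmult (Efun c n x) (Cconj (cexpi (IZR j * x)))))
      (-PI) PI = RtoC 0.

Definition normsq (k : R) (c : Z -> C) (n : Z) : R :=
  RInt (fun x => Cmod (Efun c n x) ^ 2 * wk k x) (-PI) PI.
Definition gam (k : R) (c : Z -> C) (n : Z) : R := / normsq k c n.

Definition Pterm (k : R) (E : Z -> Z -> C) (r x y : R) (n : Z) : C :=
  Cmult (RtoC (gam k (E n) n * rpow r (IZR (Z.abs n) + k)))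
        (Cmult (Efun (E n) n x) (Efun (E n) n (- y))).

Definition Psum (k : R) (E : Z -> Z -> C) (r x y : R) (N : nat) : C :=
  sum_n_m (fun m : nat => Pterm k E r x y (Z.of_nat m - Z.of_nat N)%Z) 0 (2 * N).

Definition Pint (k r x y u : R) : R :=
  (1 + u) * rpow (1 - u ^ 2) (k - 1)
  / rpow (1 - 2 * r * (cos x * cos y + u * sin x * sin y) + r ^ 2) (k + 1).

(* Main.v *)
(** The terms [n] and [-n] of the Poisson series together form the reproducing
    kernel of a two-dimensional space, spanned by the even function
    [C_m^k(cos x)] and the odd function [sin x C_{m-1}^{k+1}(cos x)] with
    [m = |n|] and [C_m^l] the Gegenbauer polynomials: orthogonality forces
    [E_m] and [E_{-m}] to be explicit combinations of these two.
    The Gegenbauer product formula (proved by induction on [m], for all [l] at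
    once, from the three-term recurrence and an integration by parts in [u]),
    applied to [C_m^k] and [C_{m-1}^{k+1}], turns this kernel into
      [(m + k) / (2 pi) * int C_m^k(cos x cos y + u sin x sin y)
                              (1 + u) (1 - u^2)^(k-1) du];
    the constant is the Wallis product [a W(a) W(a - 1) = 2 pi].
    The product formula also yields [|C_m^k| <= C_m^k(1)] on [[-1, 1]], so that
      [sum_m (m + k) r^m C_m^k(t) = k (1 - r^2) / (1 - 2 r t + r^2)^(k+1)]
    converges uniformly in [t], and may be integrated term by term. *)
Require Import Defs.
From Stdlib Require Import Reals ZArith Lra Lia Psatz.
From Coquelicot Require Import Coquelicot.
Open Scope R_scope.

(** For k < 1 the weight (1 - u^2)^(k - 1) is unbounded, so the integrals over (-1, 1) are improper.
    Integration by parts trades the parameter l for l + 1, whose weight is continuous on [-1, 1].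
    This one move gives convergence, the constant [Bt], and, in the product formula, a polynomial of
    parameter l + 1; hence l cannot stay fixed in that induction.

    The odd partner has parameter k + 1 because two sines turn the weight |sin x|^(2k) into |sin
    x|^(2k + 2). Degree plus parameter is m + k for both partners, so both parts of the kernel carry
    the same factor. The even part is the integral with weight 1, the odd part, after integration by
    parts, the integral with weight u; together they produce 1 + u.

    Uniqueness of E_n comes from definiteness: a combination of lower exponentials that is
    orthogonal to each of them is orthogonal to itself.

    The generating function is reached through its partial sums, which satisfy its differential
    equation in r up to an explicit remainder; a mean value estimate then gives the limit and its
    uniformity in t together. *)

(** * Powers with real exponent *)

Lemma rpow_gt0 (x a : R) : 0 < x -> rpow x a = Rpower x a.
Proof. intros hx; unfold rpow; destruct (Rle_dec x 0); [lra | easy]. Qed.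

Lemma rpow_le0 (x a : R) : x <= 0 -> rpow x a = 0.
Proof. intros hx; unfold rpow; destruct (Rle_dec x 0); [easy | lra]. Qed.

Lemma rpow_pos (x a : R) : 0 < x -> 0 < rpow x a.
Proof. intros hx; rewrite rpow_gt0 by easy; apply exp_pos. Qed.

Lemma rpow_nonneg (x a : R) : 0 <= rpow x a.
Proof.
unfold rpow; destruct (Rle_dec x 0); [lra | left; apply exp_pos].
Qed.

Lemma rpow_succ (x a : R) : 0 <= x -> rpow x (a + 1) = x * rpow x a.
Proof.
intros [hx | <-]; [| rewrite !rpow_le0 by lra; ring].
rewrite !rpow_gt0, Rpower_plus, Rpower_1 by easy; ring.
Qed.

(** At x = 0 both sides are 0 by the convention for [rpow], so the case r = 0 of the Poisson sum is
    covered. *)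
Lemma rpow_add_nat (x a : R) (n : nat) :
  0 <= x -> rpow x (INR n + a) = x ^ n * rpow x a.
Proof.
intros hx; induction n as [|n IH].
- simpl; rewrite Rplus_0_l; ring.
- replace (INR (S n) + a) with (INR n + a + 1) by (rewrite S_INR; ring).
  rewrite rpow_succ, IH by easy; simpl; ring.
Qed.

Lemma rpow_anti (x a b : R) : x <= 1 -> a <= b -> rpow x b <= rpow x a.
Proof.
intros hx hab; destruct (Rle_dec x 0) as [h | h].
- rewrite !rpow_le0 by easy; lra.
- rewrite !rpow_gt0 by lra; unfold Rpower.
  assert (hl : ln x <= 0).
  { destruct (Req_dec x 1) as [-> | hne]; [rewrite ln_1; lra |].
    left; rewrite <- ln_1; apply ln_increasing; lra. }
  assert (h2 : b * ln x <= a * ln x) by nra.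
  destruct h2 as [h2 | h2]; [left; now apply exp_increasing | rewrite h2; lra].
Qed.

Lemma is_derive_rpow (x a : R) :
  0 < x -> is_derive (fun y => rpow y a) x (a * rpow x (a - 1)).
Proof.
intros hx.
apply (is_derive_ext_loc (fun y => Rpower y a)).
- exists (mkposreal x hx); intros y hy; symmetry; apply rpow_gt0.
  change (Rabs (y - x) < x) in hy; apply Rabs_def2 in hy; lra.
- rewrite rpow_gt0 by easy.
  apply is_derive_Reals, derivable_pt_lim_power; easy.
Qed.

Lemma continuous_rpow (x a : R) : 0 < a -> continuous (fun y => rpow y a) x.
Proof.
intros ha.
destruct (Rtotal_order x 0) as [hx | [-> | hx]].
- apply (continuous_ext_loc _ (fun _ => 0)); [| apply continuous_const].
  assert (hx' : 0 < - x) by lra.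
  exists (mkposreal _ hx'); intros y hy; symmetry; apply rpow_le0.
  change (Rabs (y - x) < - x) in hy; apply Rabs_def2 in hy; lra.
- apply filterlim_locally; intros eps.
  (* The radius eps^(1/a) solves d^a = eps. *)
  assert (hd : 0 < Rpower eps (/ a)) by apply exp_pos.
  exists (mkposreal _ hd); intros y hy.
  change (Rabs (y - 0) < Rpower eps (/ a)) in hy.
  change (Rabs (rpow y a - rpow 0 a) < eps).
  rewrite (rpow_le0 0) by lra; rewrite Rminus_0_r in *.
  rewrite (Rabs_pos_eq (rpow y a)) by apply rpow_nonneg.
  destruct (Rle_dec y 0) as [h | h].
  + rewrite rpow_le0 by easy; apply cond_pos.
  + rewrite Rabs_pos_eq in hy by lra; rewrite rpow_gt0 by lra.
    replace (pos eps) with (Rpower (Rpower eps (/ a)) a).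
    * unfold Rpower at 1 2; apply exp_increasing.
      apply Rmult_lt_compat_l; [easy |]; apply ln_increasing; lra.
    * rewrite Rpower_mult, Rinv_l by lra; apply Rpower_1, cond_pos.
- apply (ex_derive_continuous (V := R_NormedModule)); eexists.
  now apply is_derive_rpow.
Qed.

(** The factor z makes |z|^a differentiable at 0 for every a > 0. Thanks to it the weight |sin
    x|^(2l) can be integrated by parts across the zeros of the sine, even for small l. *)
Lemma is_derive_mul_rpow_abs (y a : R) :
  0 < a ->
  is_derive (fun z => z * rpow (Rabs z) a) y ((a + 1) * rpow (Rabs y) a).
Proof.
intros ha.
destruct (Rtotal_order y 0) as [hy | [-> | hy]].
- assert (hy' : 0 < - y) by lra.
  apply (is_derive_ext_loc (fun z => - rpow (- z) (a + 1))).
  + exists (mkposreal _ hy'); intros z hz.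
    change (Rabs (z - y) < - y) in hz; apply Rabs_def2 in hz.
    rewrite rpow_succ, (Rabs_left z) by lra; simpl; ring.
  + rewrite Rabs_left by easy.
    replace ((a + 1) * rpow (- y) a)
      with (- ((-1) * ((a + 1) * rpow (- y) (a + 1 - 1))))
      by (replace (a + 1 - 1) with a by ring; ring).
    apply (is_derive_opp (V := R_NormedModule) (fun z => rpow (- z) (a + 1))).
    apply (is_derive_comp (V := R_NormedModule) (fun z => rpow z (a + 1)) Ropp).
    * now apply is_derive_rpow.
    * auto_derive; [easy | ring].
- rewrite Rabs_R0, (rpow_le0 0), Rmult_0_r by lra.
  (* At 0 the difference quotient is |h|^a, which tends to 0. *)
  apply is_derive_Reals; intros eps heps.
  destruct (proj1 (filterlim_locally _ _) (continuous_rpow 0 a ha)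
              (mkposreal eps heps)) as [d hd].
  exists d; intros h hne hh.
  rewrite Rplus_0_l, Rmult_0_l, !Rminus_0_r.
  replace (h * rpow (Rabs h) a / h) with (rpow (Rabs h) a) by (field; easy).
  assert (hb : Rabs (Rabs h - 0) < d)
    by (rewrite Rminus_0_r, Rabs_Rabsolu; easy).
  specialize (hd _ hb); change (Rabs (rpow (Rabs h) a - rpow 0 a) < eps) in hd.
  now rewrite (rpow_le0 0), Rminus_0_r in hd by lra.
- apply (is_derive_ext_loc (fun z => rpow z (a + 1))).
  + exists (mkposreal _ hy); intros z hz.
    change (Rabs (z - y) < y) in hz; apply Rabs_def2 in hz.
    rewrite rpow_succ, (Rabs_pos_eq z) by lra; easy.
  + rewrite Rabs_pos_eq by lra.
    replace (rpow y a) with (rpow y (a + 1 - 1)) by (f_equal; ring).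
    now apply is_derive_rpow.
Qed.

(** * Gegenbauer polynomials *)

(** Carrying C_n^l(t) and C_{n+1}^l(t) together makes the three-term recurrence structural and
    leaves l an arbitrary real. *)
Fixpoint geg_pair (l t : R) (n : nat) : R * R :=
  match n with
  | O => (1, 2 * l * t)
  | S m =>
      let p := geg_pair l t m in
      (snd p,
       (2 * (INR m + 1 + l) * t * snd p - (INR m + 2 * l) * fst p)
         / (INR m + 2))
  end.

Definition geg (l : R) (n : nat) (t : R) : R := fst (geg_pair l t n).

Lemma geg_0 (l t : R) : geg l 0 t = 1.
Proof. easy. Qed.

Lemma geg_1 (l t : R) : geg l 1 t = 2 * l * t.
Proof. easy. Qed.

Lemma geg_rec (l t : R) (m : nat) :
  (INR m + 2) * geg l (S (S m)) t =
  2 * (INR m + 1 + l) * t * geg l (S m) t - (INR m + 2 * l) * geg l m t.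
Proof.
pose proof (pos_INR m).
unfold geg; simpl; field; lra.
Qed.

Lemma geg_SS (l t : R) (m : nat) :
  geg l (S (S m)) t =
  2 * (INR m + 1 + l) / (INR m + 2) * (t * geg l (S m) t)
  - (INR m + 2 * l) / (INR m + 2) * geg l m t.
Proof.
pose proof (pos_INR m).
apply (Rmult_eq_reg_l (INR m + 2)); [| lra].
rewrite geg_rec; field; lra.
Qed.

Lemma nat_ind2 (P : nat -> Prop) :
  P 0%nat -> P 1%nat -> (forall m, P m -> P (S m) -> P (S (S m))) ->
  forall m, P m.
Proof.
intros h0 h1 hs m; enough (P m /\ P (S m)) by easy.
induction m as [|m [IH1 IH2]]; auto.
Qed.

(** The two relations between the parameters l and l + 1 need each other in the induction, so they
    are proved jointly. *)
Lemma geg_shift (l t : R) (m : nat) :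
  (INR m + 1 + 2 * l) * geg l (S m) t =
    2 * l * (geg (l + 1) (S m) t - t * geg (l + 1) m t) /\
  (INR m + 2) * geg l (S (S m)) t =
    2 * l * (t * geg (l + 1) (S m) t - geg (l + 1) m t).
Proof.
induction m as [|m [IH6 IH5]].
- rewrite geg_rec, !geg_1, !geg_0; simpl; split; ring.
- pose proof (pos_INR m); rewrite S_INR.
  pose proof (geg_rec l t (S m)) as hc; rewrite S_INR in hc.
  pose proof (geg_rec (l + 1) t m) as hd.
  assert (h6 : (INR m + 1 + 1 + 2 * l) * geg l (S (S m)) t =
    2 * l * (geg (l + 1) (S (S m)) t - t * geg (l + 1) (S m) t)).
  { apply (Rmult_eq_reg_l (INR m + 2)); [| lra].
    transitivity ((INR m + 2 + 2 * l) * ((INR m + 2) * geg l (S (S m)) t));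
      [ring |].
    rewrite IH5.
    transitivity (2 * l * ((INR m + 2) * geg (l + 1) (S (S m)) t
                           - (INR m + 2) * t * geg (l + 1) (S m) t)); [| ring].
    rewrite hd; ring. }
  split; [exact h6 |].
  replace (INR m + 1 + 2) with (INR m + 3) in * by ring.
  rewrite hc.
  transitivity
    (t * ((INR m + 1 + 1 + 2 * l) * geg l (S (S m)) t
          + (INR m + 2) * geg l (S (S m)) t)
     - (INR m + 1 + 2 * l) * geg l (S m) t); [ring |].
  rewrite h6, IH5, IH6; ring.
Qed.

(** The [match] encodes the convention C_{-1} = 0, which extends the shift relation to m = 0. *)
Lemma geg_shift_low (l t : R) (m : nat) :
  (INR m + 2 * l) * geg l m t =
    2 * l * (geg (l + 1) m t
             - t * match m with O => 0 | S p => geg (l + 1) p t end).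
Proof.
destruct m as [|m].
- rewrite !geg_0; simpl; ring.
- rewrite S_INR; apply geg_shift.
Qed.

Lemma geg_shift_high (l t : R) (m : nat) :
  (INR m + 1) * geg l (S m) t =
    2 * l * (t * geg (l + 1) m t
             - match m with O => 0 | S p => geg (l + 1) p t end).
Proof.
destruct m as [|m].
- rewrite geg_0, geg_1; simpl; ring.
- rewrite S_INR; replace (INR m + 1 + 1) with (INR m + 2) by ring.
  apply geg_shift.
Qed.

(** Eliminates C_{m-1}^{l+1} between the two shift relations. It is the tool that turns a squared
    sine times parameter l + 1 back into parameter l. *)
Lemma geg_contiguous (l t : R) (m : nat) :
  (1 - t * t) * (2 * l * geg (l + 1) m t) =
  (INR m + 2 * l) * geg l m t - (INR m + 1) * (t * geg l (S m) t).
Proof.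
transitivity ((INR m + 2 * l) * geg l m t
              - t * ((INR m + 1) * geg l (S m) t)); [| ring].
rewrite geg_shift_low, geg_shift_high; ring.
Qed.

(** Differentiating the recurrence leaves one undifferentiated term C_{m+2}^l; the second relation
    of [geg_shift] rewrites it at parameter l + 1, and the recurrence there closes the step. *)
Lemma is_derive_geg (l t : R) (m : nat) :
  is_derive (geg l (S m)) t (2 * l * geg (l + 1) m t).
Proof.
revert m; apply nat_ind2.
- apply (is_derive_ext (fun s => 2 * l * s)); [intros; now rewrite geg_1 |].
  rewrite geg_0; auto_derive; [easy | ring].
- apply (is_derive_ext (fun s =>
     2 * (0 + 1 + l) / (0 + 2) * (s * (2 * l * s)) - (0 + 2 * l) / (0 + 2))).
  + intros s; rewrite geg_SS, geg_1, geg_0; simpl; ring.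
  + rewrite geg_1; auto_derive; [easy | field].
- intros m IH1 IH2.
  pose proof (pos_INR m).
  apply (is_derive_ext (fun s =>
     2 * (INR (S m) + 1 + l) / (INR (S m) + 2) * (s * geg l (S (S m)) s)
     - (INR (S m) + 2 * l) / (INR (S m) + 2) * geg l (S m) s)).
  + intros s; now rewrite (geg_SS l s (S m)).
  + pose proof (S_INR m) as hS; revert hS.
    generalize (INR (S m)); intros a ->.
    auto_derive.
    * repeat split; eexists; eassumption.
    * replace (Derive (fun x : R => geg l (S (S m)) x) t)
        with (2 * l * geg (l + 1) (S m) t)
        by (symmetry; apply is_derive_unique; exact IH2).
      replace (Derive (fun x : R => geg l (S m) x) t)
        with (2 * l * geg (l + 1) m t)
        by (symmetry; apply is_derive_unique; exact IH1).
      destruct (geg_shift l t m) as [_ h5].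
      pose proof (geg_rec (l + 1) t m) as hd.
      replace (geg l (S (S m)) t)
        with (2 * l * (t * geg (l + 1) (S m) t - geg (l + 1) m t)
              / (INR m + 2))
        by (rewrite <- h5; field; lra).
      rewrite (geg_SS (l + 1) t m); field; lra.
Qed.

Lemma ex_derive_geg (l t : R) (m : nat) : ex_derive (geg l m) t.
Proof.
destruct m as [|m]; [| eexists; apply is_derive_geg].
apply (ex_derive_ext (fun _ => 1)); [easy | apply ex_derive_const].
Qed.

Lemma continuous_geg (l t : R) (m : nat) : continuous (geg l m) t.
Proof. apply (ex_derive_continuous (V := R_NormedModule)), ex_derive_geg. Qed.

Lemma geg_at_1 (l : R) (m : nat) :
  (INR m + 1) * geg l (S m) 1 = (INR m + 2 * l) * geg l m 1.
Proof.
pose proof (geg_contiguous l 1 m); lra.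
Qed.

Lemma geg_at_1_pos (l : R) (m : nat) : 0 < l -> 0 < geg l m 1.
Proof.
intros hl; induction m as [|m IH]; [rewrite geg_0; lra |].
pose proof (geg_at_1 l m); pose proof (pos_INR m); nra.
Qed.

(* The equation may be typed at a Coquelicot structure convertible to [R],
   which [ring] and [field] do not recognise. *)
Ltac to_R := match goal with |- @eq _ ?a ?b => change (@eq R a b) end.

(** * Integration against (1 - u^2)^(l - 1) *)

(** Improper at both ends, since the weight blows up there when l < 1. As a relation it states
    convergence and value at once. *)
Definition isJ (l : R) (g : R -> R) (I : R) : Prop :=
  is_RInt_gen (fun u => g u * rpow (1 - u ^ 2) (l - 1))
    (at_right (-1)) (at_left 1) I.

(** The separating point 0 guarantees a < b, which fixes the orientation of all intervals
    considered. *)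
Lemma filter_ends (P : R * R -> Prop) :
  (forall a b, -1 < a < 0 -> 0 < b < 1 -> P (a, b)) ->
  filter_prod (at_right (-1)) (at_left 1) P.
Proof.
intros hP.
apply (Filter_prod _ _ _ (fun a => -1 < a < 0) (fun b => 0 < b < 1)).
- exists (mkposreal 1 Rlt_0_1); intros a ha hlt.
  change (Rabs (a - -1) < 1) in ha; apply Rabs_def2 in ha; lra.
- exists (mkposreal 1 Rlt_0_1); intros b hb hlt.
  change (Rabs (b - 1) < 1) in hb; apply Rabs_def2 in hb; lra.
- exact hP.
Qed.

Lemma is_RInt_gen_ends_ext (f g : R -> R) (I : R) :
  (forall u, -1 < u < 1 -> f u = g u) ->
  is_RInt_gen f (at_right (-1)) (at_left 1) I ->
  is_RInt_gen g (at_right (-1)) (at_left 1) I.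
Proof.
intros h; apply is_RInt_gen_ext, filter_ends; simpl; intros a b ha hb u.
rewrite Rmin_left, Rmax_right by lra; intros hu; apply h; lra.
Qed.

Lemma isJ_ext (l : R) (g h : R -> R) (I : R) :
  (forall u, -1 < u < 1 -> g u = h u) -> isJ l g I -> isJ l h I.
Proof.
intros e; unfold isJ; apply is_RInt_gen_ends_ext; intros u hu; now rewrite e.
Qed.

Lemma isJ_plus (l : R) (g h : R -> R) (I I' : R) :
  isJ l g I -> isJ l h I' -> isJ l (fun u => g u + h u) (I + I').
Proof.
intros hg hh; unfold isJ; eapply is_RInt_gen_ends_ext.
2: exact (is_RInt_gen_plus _ _ _ _ hg hh).
intros u _; change plus with Rplus; simpl; ring.
Qed.

Lemma isJ_scal (l c : R) (g : R -> R) (I : R) :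
  isJ l g I -> isJ l (fun u => c * g u) (c * I).
Proof.
intros hg; unfold isJ; eapply is_RInt_gen_ends_ext.
2: exact (is_RInt_gen_scal _ c _ hg).
intros u _; change scal with Rmult; simpl; ring.
Qed.

Lemma isJ_unique (l : R) (g : R -> R) (I I' : R) :
  isJ l g I -> isJ l g I' -> I = I'.
Proof.
intros h h'.
now rewrite <- (is_RInt_gen_unique _ _ h), <- (is_RInt_gen_unique _ _ h').
Qed.

Lemma isJ_norm (l : R) (g h : R -> R) (I I' : R) :
  (forall u, -1 < u < 1 -> Rabs (g u) <= h u) ->
  isJ l g I -> isJ l h I' -> Rabs I <= I'.
Proof.
intros hle hg hh.
refine (RInt_gen_norm _ _ _ _ _ _ hg hh).
- apply filter_ends; simpl; intros; lra.
- apply filter_ends; simpl; intros a b ha hb u hu.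
  change (Rabs (g u * rpow (1 - u * (u * 1)) (l - 1))
          <= h u * rpow (1 - u * (u * 1)) (l - 1)).
  rewrite Rabs_mult, (Rabs_pos_eq (rpow _ _)) by apply rpow_nonneg.
  apply Rmult_le_compat_r; [apply rpow_nonneg | apply hle; lra].
Qed.

(** At the end points the primitive is only asked to be continuous, because the integrands of
    interest may be singular there. *)
Lemma is_RInt_gen_ends_FTC (F f : R -> R) :
  (forall u, -1 < u < 1 -> is_derive F u (f u)) ->
  (forall u, -1 < u < 1 -> continuous f u) ->
  continuous F (-1) -> continuous F 1 ->
  is_RInt_gen f (at_right (-1)) (at_left 1) (F 1 - F (-1)).
Proof.
intros hd hc hm hp.
apply (is_RInt_gen_ends_ext (Derive F)).
{ intros u hu; now apply is_derive_unique, hd. }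
apply is_RInt_gen_Derive.
- apply filter_ends; simpl; intros a b ha hb u.
  rewrite Rmin_left, Rmax_right by lra; intros hu.
  eexists; apply hd; lra.
- apply filter_ends; simpl; intros a b ha hb u.
  rewrite Rmin_left, Rmax_right by lra; intros hu.
  apply (continuous_ext_loc _ f); [| apply hc; lra].
  assert (he : 0 < Rmin (u + 1) (1 - u)) by (apply Rmin_pos; lra).
  exists (mkposreal _ he); intros v hv.
  change (Rabs (v - u) < Rmin (u + 1) (1 - u)) in hv.
  pose proof (Rmin_l (u + 1) (1 - u)); pose proof (Rmin_r (u + 1) (1 - u)).
  apply Rabs_def2 in hv; symmetry; apply is_derive_unique, hd; lra.
- eapply filterlim_filter_le_1; [| exact hm]; apply filter_le_within.
- eapply filterlim_filter_le_1; [| exact hp]; apply filter_le_within.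
Qed.

Lemma continuous_rpow_ends (l u : R) :
  0 < l -> continuous (fun v => rpow (1 - v ^ 2) l) u.
Proof.
intros hl.
apply (continuous_comp (fun v => 1 - v ^ 2) (fun z => rpow z l)).
- apply (ex_derive_continuous (V := R_NormedModule)); auto_derive; easy.
- now apply continuous_rpow.
Qed.

(** The derivative of (1 - u^2)^l is -2 l u (1 - u^2)^(l-1), and the boundary terms vanish because l
    > 0. The price for removing the factor u is a derivative and the parameter l + 1. *)
Lemma isJ_parts (l : R) (f df : R -> R) (I : R) :
  0 < l ->
  (forall u, -1 <= u <= 1 -> is_derive f u (df u)) ->
  (forall u, -1 < u < 1 -> continuous df u) ->
  isJ (l + 1) df I -> isJ l (fun u => u * f u) (/ (2 * l) * I).
Proof.
intros hl hd hc hI.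
assert (hF : is_RInt_gen
  (fun u => df u * rpow (1 - u ^ 2) l
            - 2 * l * (u * f u) * rpow (1 - u ^ 2) (l - 1))
  (at_right (-1)) (at_left 1) 0).
{ set (F := fun u => f u * rpow (1 - u ^ 2) l).
  replace 0 with (F 1 - F (-1))
    by (unfold F; rewrite !(rpow_le0 (1 - _)) by lra; ring).
  assert (hfc : forall u, -1 <= u <= 1 -> continuous f u).
  { intros u hu; apply (ex_derive_continuous (V := R_NormedModule)).
    eexists; now apply hd. }
  apply is_RInt_gen_ends_FTC.
  - intros u hu; unfold F.
    assert (hp : 0 < 1 - u ^ 2) by nra.
    assert (hr : is_derive (fun v => rpow (1 - v ^ 2) l) u
                   ((- 2 * u) * (l * rpow (1 - u ^ 2) (l - 1)))).
    { apply (is_derive_comp (V := R_NormedModule) (fun z => rpow z l)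
               (fun v => 1 - v ^ 2)).
      - now apply is_derive_rpow.
      - auto_derive; [easy | ring]. }
    replace (df u * rpow (1 - u ^ 2) l
             - 2 * l * (u * f u) * rpow (1 - u ^ 2) (l - 1))
      with (df u * rpow (1 - u ^ 2) l
            + f u * ((- 2 * u) * (l * rpow (1 - u ^ 2) (l - 1)))) by ring.
    apply (is_derive_mult f (fun v => rpow (1 - v ^ 2) l) u);
      [apply hd; lra | exact hr | intros; apply Rmult_comm].
  - intros u hu.
    assert (hp : 0 < 1 - u ^ 2) by nra.
    apply (continuous_minus (V := R_NormedModule)).
    + apply (continuous_mult (K := R_AbsRing) df);
        [now apply hc | now apply continuous_rpow_ends].
    + apply (continuous_mult (K := R_AbsRing) (fun u => 2 * l * (u * f u))).
      * apply (continuous_mult (K := R_AbsRing) (fun _ => 2 * l));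
          [apply continuous_const |].
        apply (continuous_mult (K := R_AbsRing) (fun v => v));
          [apply continuous_id | apply hfc; lra].
      * apply (continuous_comp (fun v => 1 - v ^ 2) (fun z => rpow z (l - 1))).
        -- apply (ex_derive_continuous (V := R_NormedModule)); auto_derive; easy.
        -- apply (ex_derive_continuous (V := R_NormedModule)).
           eexists; now apply is_derive_rpow.
  - apply (continuous_mult (K := R_AbsRing) f);
      [apply hfc; lra | now apply continuous_rpow_ends].
  - apply (continuous_mult (K := R_AbsRing) f);
      [apply hfc; lra | now apply continuous_rpow_ends]. }
unfold isJ in *.
replace (l + 1 - 1) with l in hI by ring.
pose proof (is_RInt_gen_scal _ (/ (2 * l)) _ (is_RInt_gen_minus _ _ _ _ hI hF))
  as h.
replace (/ (2 * l) * I) with (scal (/ (2 * l)) (minus I 0)).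
2: { change scal with Rmult; change minus with Rminus; simpl; ring. }
eapply is_RInt_gen_ends_ext; [| exact h].
intros u _; change scal with Rmult; change minus with Rminus; simpl.
field; lra.
Qed.

(** The margin r0 > 1 makes the primitive based at -1 differentiable, hence continuous, at both end
    points. *)
Lemma isJ_proper (l r0 : R) (h : R -> R) :
  0 < l -> 1 < r0 -> (forall u, - r0 < u < r0 -> continuous h u) ->
  isJ (l + 1) h (RInt (fun u => h u * rpow (1 - u ^ 2) l) (-1) 1).
Proof.
intros hl hr hc.
set (psi := fun u => h u * rpow (1 - u ^ 2) l).
assert (hpc : forall u, - r0 < u < r0 -> continuous psi u).
{ intros u hu; apply (continuous_mult (K := R_AbsRing) h);
    [now apply hc | now apply continuous_rpow_ends]. }
assert (hder : forall u, - r0 < u < r0 -> is_derive (RInt psi (-1)) u (psi u)).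
{ intros u hu; apply (is_derive_RInt (V := R_NormedModule) psi _ (-1)).
  - assert (he : 0 < Rmin (u + r0) (r0 - u)) by (apply Rmin_pos; lra).
    exists (mkposreal _ he); intros v hv.
    change (Rabs (v - u) < Rmin (u + r0) (r0 - u)) in hv.
    pose proof (Rmin_l (u + r0) (r0 - u)).
    pose proof (Rmin_r (u + r0) (r0 - u)).
    apply Rabs_def2 in hv.
    apply (RInt_correct (V := R_CompleteNormedModule)).
    apply (ex_RInt_continuous (V := R_CompleteNormedModule)).
    intros z hz; apply hpc.
    destruct (Rle_dec (-1) v);
      [rewrite Rmin_left, Rmax_right in hz by lra
      | rewrite Rmin_right, Rmax_left in hz by lra]; lra.
  - now apply hpc. }
unfold isJ; replace (l + 1 - 1) with l by ring.
replace (RInt psi (-1) 1) with (RInt psi (-1) 1 - RInt psi (-1) (-1)).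
2: { rewrite RInt_point; change zero with 0; ring. }
apply (is_RInt_gen_ends_FTC (RInt psi (-1)) psi).
- intros u hu; apply hder; lra.
- intros u hu; apply hpc; lra.
- apply (ex_derive_continuous (V := R_NormedModule)).
  eexists; apply hder; lra.
- apply (ex_derive_continuous (V := R_NormedModule)).
  eexists; apply hder; lra.
Qed.

Lemma isJ_raise (l : R) (g : R -> R) (I : R) :
  isJ (l + 1) g I -> isJ l (fun u => (1 - u ^ 2) * g u) I.
Proof.
unfold isJ; apply is_RInt_gen_ends_ext; intros u hu.
replace (l + 1 - 1) with (l - 1 + 1) by ring.
rewrite rpow_succ by nra; ring.
Qed.

(** Splits g = u (u g) + (1 - u^2) g: the first summand is integrated by parts, the second absorbs a
    power of the weight, and both end at parameter l + 1 with a continuous weight. *)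
Lemma isJ_ex (l r0 : R) (g dg : R -> R) :
  0 < l -> 1 < r0 ->
  (forall u, - r0 < u < r0 -> is_derive g u (dg u)) ->
  (forall u, - r0 < u < r0 -> continuous dg u) ->
  exists I, isJ l g I.
Proof.
intros hl hr hd hc.
assert (hgc : forall u, - r0 < u < r0 -> continuous g u).
{ intros u hu; apply (ex_derive_continuous (V := R_NormedModule)).
  eexists; now apply hd. }
set (d := fun u => g u + u * dg u).
assert (hdc : forall u, - r0 < u < r0 -> continuous d u).
{ intros u hu; apply (continuous_plus (V := R_NormedModule)); [now apply hgc |].
  apply (continuous_mult (K := R_AbsRing) (fun v => v));
    [apply continuous_id | now apply hc]. }
eexists; eapply isJ_ext.
2: { apply isJ_plus.
     - apply (isJ_parts l (fun u => u * g u) d); [easy | | |].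
       + intros u hu; unfold d.
         replace (g u + u * dg u) with (1 * g u + u * dg u) by ring.
         apply (is_derive_mult (fun v => v) g u);
           [apply (is_derive_id (K := R_AbsRing)) | apply hd; lra
           | intros; apply Rmult_comm].
       + intros u hu; apply hdc; lra.
       + now apply (isJ_proper l r0).
     - apply isJ_raise; now apply (isJ_proper l r0 g). }
intros u _; simpl; ring.
Qed.

Definition beta_int (l : R) : R := RInt (fun u => rpow (1 - u ^ 2) l) (-1) 1.

(* The improper integral of [(1 - u^2)^(l - 1)] over [(-1, 1)] (see [isJ_1]),
   reduced by parts to a proper one. *)
Definition Bt (l : R) : R := (2 * l + 1) / (2 * l) * beta_int l.

Lemma isJ_succ_1 (l : R) :
  0 < l -> isJ (l + 1) (fun _ => 1) (beta_int l).
Proof.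
intros hl; unfold beta_int.
replace (RInt (fun u => rpow (1 - u ^ 2) l) (-1) 1)
  with (RInt (fun u => 1 * rpow (1 - u ^ 2) l) (-1) 1).
- apply (isJ_proper l 2); [easy | lra | intros; apply continuous_const].
- apply RInt_ext; intros; to_R; ring.
Qed.

(** The splitting 1 = u u + (1 - u^2) gives the two summands b / (2l) and b of [Bt]. *)
Lemma isJ_1 (l : R) : 0 < l -> isJ l (fun _ => 1) (Bt l).
Proof.
intros hl; pose proof (isJ_succ_1 l hl) as h.
unfold Bt; set (b := beta_int l) in *.
replace ((2 * l + 1) / (2 * l) * b) with (/ (2 * l) * b + b) by (field; lra).
eapply isJ_ext.
2: { apply isJ_plus.
     - apply (isJ_parts l (fun u => u) (fun _ => 1)); [easy | | | exact h].
       + intros; apply (is_derive_id (K := R_AbsRing)).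
       + intros; apply continuous_const.
     - exact (isJ_raise _ _ _ h). }
intros u _; simpl; ring.
Qed.

(** Integration by parts with constant f replaces the parity argument: the derivative is 0. *)
Lemma isJ_id (l : R) : 0 < l -> isJ l (fun u => u) 0.
Proof.
intros hl.
replace 0 with (/ (2 * l) * (0 * Bt (l + 1))) by ring.
apply (isJ_ext _ (fun u => u * 1)); [intros; ring |].
apply (isJ_parts l (fun _ => 1) (fun _ => 0 * 1)); [easy | | |].
- intros; rewrite Rmult_0_l; apply (is_derive_const (V := R_NormedModule)).
- intros; apply continuous_const.
- apply (isJ_scal _ 0 (fun _ => 1)), isJ_1; lra.
Qed.

(** [Bt (l + 1)] and [beta_int l] are two values of the same integral. *)
Lemma Bt_succ (l : R) : 0 < l -> Bt (l + 1) = 2 * l / (2 * l + 1) * Bt l.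
Proof.
intros hl.
rewrite (isJ_unique _ _ _ _ (isJ_1 (l + 1) ltac:(lra)) (isJ_succ_1 l hl)).
unfold Bt; field; lra.
Qed.

(** * The product formula *)

(** The only possible constant of the product formula: at t = 1, q = 0 the integrand is the constant
    C_m(s). *)
Definition kap (l : R) (m : nat) : R := Bt l / geg l m 1.

Lemma kap_S (l : R) (m : nat) :
  0 < l -> kap l (S m) = (INR m + 1) / (INR m + 2 * l) * kap l m.
Proof.
intros hl; unfold kap.
pose proof (geg_at_1 l m); pose proof (geg_at_1_pos l m hl).
pose proof (geg_at_1_pos l (S m) hl); pose proof (pos_INR m).
replace (geg l (S m) 1) with ((INR m + 2 * l) / (INR m + 1) * geg l m 1).
- field; lra.
- apply (Rmult_eq_reg_l (INR m + 1)); [| lra].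
  rewrite geg_at_1; field; lra.
Qed.

(** Integration by parts leads from degree m + 1 at parameter l to degree m at parameter l + 1; this
    compares the two constants. *)
Lemma kap_shift (l : R) (m : nat) :
  0 < l ->
  kap (l + 1) m =
  (2 * l) ^ 2 / ((INR m + 1) * (INR m + 1 + 2 * l)) * kap l (S m).
Proof.
intros hl; induction m as [|m IH].
- rewrite kap_S by easy; unfold kap; rewrite !geg_0, Bt_succ by easy.
  simpl; field; lra.
- rewrite (kap_S (l + 1)), (kap_S l (S m)), IH by lra.
  pose proof (pos_INR m); rewrite S_INR; field; lra.
Qed.

Lemma isJ_geg_mul (l s t p q I : R) (m : nat) :
  0 < l -> isJ (l + 1) (fun u => geg (l + 1) m (s * t + u * (p * q))) I ->
  isJ l (fun u => u * geg l (S m) (s * t + u * (p * q))) (p * q * I).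
Proof.
intros hl h.
replace (p * q * I) with (/ (2 * l) * ((2 * l * (p * q)) * I)) by (field; lra).
apply (isJ_parts l _
  (fun u => 2 * l * (p * q) * geg (l + 1) m (s * t + u * (p * q))));
  [easy | | | now apply isJ_scal].
- intros u _.
  replace (2 * l * (p * q) * geg (l + 1) m (s * t + u * (p * q)))
    with ((p * q) * (2 * l * geg (l + 1) m (s * t + u * (p * q)))) by ring.
  apply (is_derive_comp (V := R_NormedModule) (geg l (S m))
           (fun v => s * t + v * (p * q))).
  + apply is_derive_geg.
  + auto_derive; [easy | ring].
- intros u _.
  apply (continuous_mult (K := R_AbsRing) (fun _ => 2 * l * (p * q)));
    [apply continuous_const |].
  apply (continuous_comp (fun v => s * t + v * (p * q)));
    [| apply continuous_geg].
  apply (ex_derive_continuous (V := R_NormedModule)); auto_derive; easy.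
Qed.

(** Multiplication by s t in the recurrence keeps the parameter; multiplication by u p q goes
    through [isJ_geg_mul] to degree m at parameter l + 1. Here p and q play the sines, with free
    signs. *)
Theorem geg_product (l s t p q : R) (m : nat) :
  0 < l -> p * p = 1 - s * s -> q * q = 1 - t * t ->
  isJ l (fun u => geg l m (s * t + u * (p * q)))
    (kap l m * geg l m s * geg l m t).
Proof.
intros hl hp hq; revert l hl; revert m.
apply (nat_ind2 (fun m => forall l, 0 < l ->
  isJ l (fun u => geg l m (s * t + u * (p * q)))
    (kap l m * geg l m s * geg l m t))).
- intros l hl; unfold kap; rewrite !geg_0.
  replace (Bt l / 1 * 1 * 1) with (Bt l) by field.
  now apply isJ_1.
- intros l hl; rewrite kap_S by easy; unfold kap; rewrite !geg_1, geg_0.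
  pose proof (isJ_1 l hl) as h1.
  pose proof (isJ_id l hl) as hu.
  replace ((INR 0 + 1) / (INR 0 + 2 * l) * (Bt l / 1) * (2 * l * s) * (2 * l * t))
    with ((2 * l * s * t) * Bt l
          + (2 * l * (p * q)) * 0)
    by (simpl; field; lra).
  eapply isJ_ext; [| exact (isJ_plus _ _ _ _ _
      (isJ_scal _ _ _ _ h1) (isJ_scal _ _ _ _ hu))].
  intros u _; simpl; rewrite geg_1; ring.
- intros m IH0 IH1 l hl.
  pose proof (isJ_geg_mul l s t p q _ m hl (IH0 (l + 1) ltac:(lra))) as hu.
  specialize (IH0 l hl); specialize (IH1 l hl).
  pose proof (pos_INR m) as hm.
  set (al := 2 * (INR m + 1 + l) / (INR m + 2)).
  set (be := (INR m + 2 * l) / (INR m + 2)).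
  replace (kap l (S (S m)) * geg l (S (S m)) s * geg l (S (S m)) t)
    with ((al * (s * t)) * (kap l (S m) * geg l (S m) s * geg l (S m) t)
          + (al * (p * q)) * (p * q * (kap (l + 1) m * geg (l + 1) m s
                                       * geg (l + 1) m t))
          + (- be) * (kap l m * geg l m s * geg l m t)).
  (* The sines now occur only as p^2 = 1 - s^2 and q^2 = 1 - t^2, so [geg_contiguous] returns both
     factors to parameter l and a rational identity remains. *)
  2: { pose proof (geg_contiguous l s m) as hs.
    pose proof (geg_contiguous l t m) as ht.
    replace (al * (p * q) * (p * q * (kap (l + 1) m * geg (l + 1) m s
                                      * geg (l + 1) m t)))
      with (al * (kap (l + 1) m / (2 * l) ^ 2)
            * ((p * p) * (2 * l * geg (l + 1) m s))
            * ((q * q) * (2 * l * geg (l + 1) m t)))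
      by (field; lra).
    rewrite hp, hq, hs, ht, kap_shift by easy.
    rewrite (kap_S l (S m)), S_INR, !geg_SS by easy.
    rewrite (kap_S l m) by easy.
    unfold al, be; field; repeat split; lra. }
  eapply isJ_ext; [| exact (isJ_plus _ _ _ _ _ (isJ_plus _ _ _ _ _
      (isJ_scal _ _ _ _ IH1) (isJ_scal _ _ _ _ hu))
      (isJ_scal _ _ _ _ IH0))].
  intros u _; simpl; rewrite (geg_SS l _ m).
  unfold al, be; field; lra.
Qed.


(** * Positivity of the constants and the maximum of the Gegenbauer polynomials *)

Lemma beta_int_pos (l : R) : 0 < l -> 0 < beta_int l.
Proof.
intros hl; apply RInt_gt_0; [lra | |].
- intros u hu; apply rpow_pos; nra.
- intros u _; now apply continuous_rpow_ends.
Qed.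

Lemma Bt_pos (l : R) : 0 < l -> 0 < Bt l.
Proof.
intros hl; pose proof (beta_int_pos l hl); unfold Bt.
apply Rmult_lt_0_compat; [apply Rdiv_lt_0_compat |]; lra.
Qed.

(* If [M] is the maximum of [|geg l m|] on [[-1, 1]], attained at [s], the
   product formula with [t = s] gives [M ^ 2 <= geg l m 1 * M]. *)
Lemma geg_le_at_1 (l t : R) (m : nat) :
  0 < l -> -1 <= t <= 1 -> Rabs (geg l m t) <= geg l m 1.
Proof.
intros hl ht.
destruct (continuity_ab_maj (fun s => Rabs (geg l m s)) (-1) 1 ltac:(lra))
  as [s [hmax hs]].
{ intros s _.
  apply (continuity_pt_comp (geg l m) Rabs); [| apply Rcontinuity_abs].
  apply continuity_pt_filterlim, continuous_geg. }
simpl in hmax.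
assert (hsq : sqrt (1 - s * s) * sqrt (1 - s * s) = 1 - s * s)
  by (apply sqrt_sqrt; nra).
pose proof (geg_product l s s _ _ m hl hsq hsq) as hJ.
pose proof (Bt_pos l hl) as hB; pose proof (geg_at_1_pos l m hl) as h1.
assert (hle : Rabs (kap l m * geg l m s * geg l m s)
              <= Rabs (geg l m s) * Bt l).
{ refine (isJ_norm l _ (fun _ => Rabs (geg l m s) * 1) _ _ _ hJ _).
  - intros u hu; rewrite Rmult_1_r; apply hmax; rewrite hsq; nra.
  - now apply (isJ_scal l _ (fun _ => 1)), isJ_1. }
set (M := Rabs (geg l m s)) in *.
assert (hM : 0 <= M) by apply Rabs_pos.
assert (hle' : M * M <= geg l m 1 * M).
{ unfold kap in hle; rewrite !Rabs_mult in hle; fold M in hle.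
  rewrite Rabs_pos_eq in hle
    by (apply Rlt_le, Rdiv_lt_0_compat; easy).
  apply (Rmult_le_reg_l (Bt l / geg l m 1)); [now apply Rdiv_lt_0_compat |].
  replace (Bt l / geg l m 1 * (geg l m 1 * M)) with (M * Bt l)
    by (field; lra).
  lra. }
specialize (hmax t ht); nra.
Qed.

(** * The generating function *)

Definition gen_den (r t : R) : R := 1 - 2 * r * t + r ^ 2.

Definition gsum (l t : R) (N : nat) (r : R) : R :=
  sum_f_R0 (fun m => geg l m t * r ^ m) N.

Definition dgsum (l t : R) (N : nat) (r : R) : R :=
  sum_f_R0 (fun m => INR m * geg l m t * r ^ (pred m)) N.

Definition hsum (l t : R) (N : nat) (r : R) : R :=
  sum_f_R0 (fun m => (INR m + l) * geg l m t * r ^ m) N.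

(** The full generating function G = D^(-l), with D = [gen_den], solves D G' = 2 l (t - r) G; this
    is the defect of the partial sum in that equation. *)
Definition gsum_err (l t : R) (N : nat) (r : R) : R :=
  (INR N + 2 * l) * geg l N t * r ^ S N
  - (INR N + 1) * geg l (S N) t * r ^ N.

Lemma is_derive_gsum (l t r : R) (N : nat) :
  is_derive (gsum l t N) r (dgsum l t N r).
Proof.
induction N as [|N IH].
- unfold gsum, dgsum; simpl.
  apply (is_derive_ext (fun _ => geg l 0 t * 1)); [easy |].
  rewrite !Rmult_0_l; apply (is_derive_const (V := R_NormedModule)).
- apply (is_derive_plus (V := R_NormedModule) (gsum l t N)
           (fun r => geg l (S N) t * r ^ S N)); [exact IH |].
  rewrite (Rmult_comm (INR (S N))), Rmult_assoc.
  apply (is_derive_scal (fun r => r ^ S N)).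
  apply is_derive_Reals, derivable_pt_lim_pow.
Qed.

Lemma gsum_ode (l t r : R) (N : nat) :
  gen_den r t * dgsum l t N r - 2 * l * (t - r) * gsum l t N r
  = gsum_err l t N r.
Proof.
unfold gsum_err, gen_den; induction N as [|N IH].
- unfold gsum, dgsum; simpl; rewrite geg_0, geg_1; ring.
- unfold gsum, dgsum in *; rewrite !tech5, Nat.pred_succ.
  pose proof (geg_rec l t N) as h.
  replace (INR (S N) + 1) with (INR N + 2) by (rewrite S_INR; ring).
  rewrite h; revert IH.
  generalize (sum_f_R0 (fun m => geg l m t * r ^ m) N)
    (sum_f_R0 (fun m => INR m * geg l m t * r ^ pred m) N); intros a b IH.
  replace ((1 - 2 * r * t + r ^ 2) * (b + INR (S N) * geg l (S N) t * r ^ N)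
           - 2 * l * (t - r) * (a + geg l (S N) t * r ^ S N))
    with (((1 - 2 * r * t + r ^ 2) * b - 2 * l * (t - r) * a)
          + ((1 - 2 * r * t + r ^ 2) * (INR (S N) * geg l (S N) t * r ^ N)
             - 2 * l * (t - r) * (geg l (S N) t * r ^ S N))) by ring.
  rewrite IH, S_INR; simpl; ring.
Qed.

Lemma hsum_gsum (l t r : R) (N : nat) :
  hsum l t N r = r * dgsum l t N r + l * gsum l t N r.
Proof.
unfold hsum, dgsum, gsum; induction N as [|N IH]; [simpl; ring |].
rewrite !tech5, IH; simpl; ring.
Qed.

(** Weighting the terms by m + l amounts to r d/dr + l; inserting the differential equation leaves l
    D + 2 l r (t - r) = l (1 - r^2), the numerator of the Poisson kernel. *)
Lemma gen_den_hsum (l t r : R) (N : nat) :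
  gen_den r t * hsum l t N r
  = l * (1 - r ^ 2) * gsum l t N r + r * gsum_err l t N r.
Proof.
rewrite <- gsum_ode, hsum_gsum; unfold gen_den; ring.
Qed.

Lemma gen_den_bounds (r0 r t : R) :
  0 <= r <= r0 -> r0 < 1 -> -1 <= t <= 1 ->
  (1 - r0) ^ 2 <= gen_den r t <= 4.
Proof. intros hr hr0 ht; unfold gen_den; split; nra. Qed.

(** The exponent may have either sign, so the logarithms of both ends of [d, 4] enter the bound. *)
Lemma rpow_bounded (d a : R) :
  0 < d -> exists M, 0 < M /\ forall x, d <= x <= 4 -> rpow x a <= M.
Proof.
intros hd.
exists (exp (Rabs a * (Rabs (ln d) + Rabs (ln 4)))); split; [apply exp_pos |].
intros x hx; rewrite rpow_gt0 by lra; unfold Rpower.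
assert (h : a * ln x <= Rabs a * (Rabs (ln d) + Rabs (ln 4))).
{ eapply Rle_trans; [apply Rle_abs |]; rewrite Rabs_mult.
  apply Rmult_le_compat_l; [apply Rabs_pos |].
  assert (h1 : ln d <= ln x)
    by (destruct (Req_dec d x) as [-> | ]; [lra | left; apply ln_increasing; lra]).
  assert (h2 : ln x <= ln 4)
    by (destruct (Req_dec x 4) as [-> | ]; [lra | left; apply ln_increasing; lra]).
  pose proof (Rle_abs (ln 4)); pose proof (Rabs_maj2 (ln d)).
  pose proof (Rabs_pos (ln 4)); pose proof (Rabs_pos (ln d)).
  apply Rabs_le; lra. }
destruct h as [h | ->]; [left; now apply exp_increasing | lra].
Qed.

(** By [geg_at_1] the two terms of [gsum_err] have this common coefficient at t = 1. *)
Definition geg_tail (l r : R) (N : nat) : R :=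
  (INR N + 1) * geg l (S N) 1 * r ^ N.

Lemma geg_tail_nonneg (l r : R) (N : nat) :
  0 < l -> 0 <= r -> 0 <= geg_tail l r N.
Proof.
intros hl hr; unfold geg_tail.
pose proof (geg_at_1_pos l (S N) hl); pose proof (pos_INR N).
pose proof (pow_le r N hr); apply Rmult_le_pos; nra.
Qed.

(** The bound is uniform in r up to r0, because the mean value theorem will evaluate the defect at
    an unknown intermediate point. *)
Lemma gsum_err_bound (l r0 r t : R) (N : nat) :
  0 < l -> 0 <= r <= r0 -> r0 < 1 -> -1 <= t <= 1 ->
  Rabs (gsum_err l t N r) <= 2 * geg_tail l r0 N.
Proof.
intros hl hr hr0 ht; unfold gsum_err, geg_tail.
pose proof (geg_le_at_1 l t N hl ht) as h1.
pose proof (geg_le_at_1 l t (S N) hl ht) as h2.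
pose proof (geg_at_1 l N) as h3; pose proof (pos_INR N) as hN.
pose proof (pow_incr r r0 N hr) as h4; pose proof (pow_le r N (proj1 hr)) as h5.
assert (h6 : r ^ S N <= r0 ^ N) by (simpl; nra).
assert (h7 : 0 <= r ^ S N) by (apply pow_le; easy).
assert (ha : Rabs ((INR N + 2 * l) * geg l N t * r ^ S N)
             <= (INR N + 2 * l) * geg l N 1 * r0 ^ N).
{ rewrite !Rabs_mult, (Rabs_pos_eq (INR N + 2 * l)), (Rabs_pos_eq (r ^ _))
    by lra.
  apply Rmult_le_compat; [| easy | | easy].
  - apply Rmult_le_pos; [lra | apply Rabs_pos].
  - apply Rmult_le_compat_l; [lra | easy]. }
assert (hb : Rabs ((INR N + 1) * geg l (S N) t * r ^ N)
             <= (INR N + 1) * geg l (S N) 1 * r0 ^ N).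
{ rewrite !Rabs_mult, (Rabs_pos_eq (INR N + 1)), (Rabs_pos_eq (r ^ _)) by lra.
  apply Rmult_le_compat; [| easy | | easy].
  - apply Rmult_le_pos; [lra | apply Rabs_pos].
  - apply Rmult_le_compat_l; [lra | easy]. }
eapply Rle_trans; [apply Rabs_triang |]; rewrite Rabs_Ropp.
rewrite <- h3 in ha; lra.
Qed.

(** D^l is the integrating factor of the differential equation, so only the defect survives. *)
Lemma is_derive_gsum_rpow (l t r : R) (N : nat) :
  0 < gen_den r t ->
  is_derive (fun r => gsum l t N r * rpow (gen_den r t) l) r
    (rpow (gen_den r t) (l - 1) * gsum_err l t N r).
Proof.
intros hD.
assert (hr : is_derive (fun r => rpow (gen_den r t) l) r
               ((2 * r - 2 * t) * (l * rpow (gen_den r t) (l - 1)))).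
{ apply (is_derive_comp (V := R_NormedModule) (fun z => rpow z l)
           (fun r => gen_den r t)).
  - now apply is_derive_rpow.
  - unfold gen_den; auto_derive; [easy | ring]. }
replace (rpow (gen_den r t) (l - 1) * gsum_err l t N r)
  with (dgsum l t N r * rpow (gen_den r t) l
        + gsum l t N r * ((2 * r - 2 * t) * (l * rpow (gen_den r t) (l - 1)))).
- apply (is_derive_mult (gsum l t N) (fun r => rpow (gen_den r t) l) r);
    [apply is_derive_gsum | exact hr | intros; apply Rmult_comm].
- rewrite <- gsum_ode.
  replace (rpow (gen_den r t) l) with (gen_den r t * rpow (gen_den r t) (l - 1)).
  + ring.
  + rewrite <- rpow_succ by lra; f_equal; ring.
Qed.

(** The product of the partial sum and D^l equals 1 at r = 0, and its derivative is bounded by the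
    defect; the mean value theorem on [0, r] concludes. *)
Lemma gsum_approx (l r t M : R) (N : nat) :
  0 < l -> 0 <= r < 1 -> -1 <= t <= 1 -> 0 < M ->
  (forall x, (1 - r) ^ 2 <= x <= 4 -> rpow x (l - 1) <= M) ->
  Rabs (gsum l t N r * rpow (gen_den r t) l - 1) <= M * (2 * geg_tail l r N).
Proof.
intros hl hr ht hM hb.
assert (hpos : forall s, 0 <= s <= r -> 0 < gen_den s t).
{ intros s hs; destruct (gen_den_bounds r s t hs ltac:(lra) ht); nra. }
destruct (MVT_gen (fun r => gsum l t N r * rpow (gen_den r t) l) 0 r
            (fun r => rpow (gen_den r t) (l - 1) * gsum_err l t N r))
  as [c [hc he]].
- rewrite Rmin_left, Rmax_right by lra; intros s hs.
  apply is_derive_gsum_rpow, hpos; lra.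
- rewrite Rmin_left, Rmax_right by lra; intros s hs.
  apply continuity_pt_filterlim.
  apply (ex_derive_continuous (V := R_NormedModule)
           (fun r => gsum l t N r * rpow (gen_den r t) l) s).
  eexists; apply is_derive_gsum_rpow, hpos; lra.
- rewrite Rmin_left, Rmax_right in hc by lra.
  assert (h0 : gsum l t N 0 * rpow (gen_den 0 t) l = 1).
  { replace (gen_den 0 t) with 1 by (unfold gen_den; ring).
    rewrite rpow_gt0 by lra; unfold Rpower; rewrite ln_1, Rmult_0_r, exp_0.
    rewrite Rmult_1_r; unfold gsum; clear.
    induction N as [|N IH]; [simpl; rewrite geg_0; ring |].
    rewrite tech5, IH, pow_i by lia; ring. }
  rewrite h0 in he; rewrite he.
  pose proof (gsum_err_bound l r c t N hl hc ltac:(lra) ht) as h1.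
  pose proof (hb _ (gen_den_bounds r c t hc ltac:(lra) ht)) as h2.
  pose proof (rpow_nonneg (gen_den c t) (l - 1)) as h3.
  rewrite !Rabs_mult, (Rabs_pos_eq (rpow _ _)), (Rabs_pos_eq (r - 0)) by lra.
  pose proof (Rabs_pos (gsum_err l t N c)).
  assert (rpow (gen_den c t) (l - 1) * Rabs (gsum_err l t N c)
          <= M * (2 * geg_tail l r N)) by (apply Rmult_le_compat; lra).
  assert (0 <= rpow (gen_den c t) (l - 1) * Rabs (gsum_err l t N c))
    by (apply Rmult_le_pos; lra).
  nra.
Qed.

(** Divide [gen_den_hsum] by D. Since D lies in [(1 - r)^2, 4] for all t in [-1, 1], the constant K
    is independent of t and N. *)
Theorem hsum_approx (l r : R) :
  0 < l -> 0 <= r < 1 ->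
  exists K, forall N t, -1 <= t <= 1 ->
  Rabs (hsum l t N r - l * (1 - r ^ 2) / rpow (gen_den r t) (l + 1))
  <= K * geg_tail l r N.
Proof.
intros hl hr.
assert (hd : 0 < (1 - r) ^ 2) by nra.
destruct (rpow_bounded _ (l - 1) hd) as [M [hM hMb]].
destruct (rpow_bounded _ (- l) hd) as [M' [hM' hMb']].
exists (/ (1 - r) ^ 2 * (l * M' * M * 2 + 2)); intros N t ht.
destruct (gen_den_bounds r r t ltac:(lra) ltac:(lra) ht) as [hD hD4].
pose proof (gsum_approx l r t M N hl hr ht hM hMb) as h1.
pose proof (gsum_err_bound l r r t N hl ltac:(lra) ltac:(lra) ht) as h2.
pose proof (hMb' _ (conj hD hD4)) as h3.
pose proof (gen_den_hsum l t r N) as h4.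
pose proof (geg_tail_nonneg l r N hl (proj1 hr)) as h5.
assert (hp : 0 < rpow (gen_den r t) l) by (apply rpow_pos; lra).
assert (hinv : rpow (gen_den r t) (- l) = / rpow (gen_den r t) l).
{ rewrite !rpow_gt0 by lra; apply Rpower_Ropp. }
rewrite hinv in h3; rewrite rpow_succ by lra.
set (D := gen_den r t) in *; set (p := rpow D l) in *.
set (z := geg_tail l r N) in *; set (e := gsum_err l t N r) in *.
set (g := gsum l t N r) in *.
replace (hsum l t N r - l * (1 - r ^ 2) / (D * p))
  with (/ D * (l * (1 - r ^ 2) * (/ p * (g * p - 1)) + r * e)).
2: { replace (hsum l t N r) with (/ D * (D * hsum l t N r)) by (field; lra).
     rewrite h4; field; lra. }
rewrite Rabs_mult, Rabs_pos_eq by (left; apply Rinv_0_lt_compat; lra).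
rewrite (Rmult_assoc _ _ z); apply Rmult_le_compat.
- left; apply Rinv_0_lt_compat; lra.
- apply Rabs_pos.
- apply Rinv_le_contravar; lra.
- eapply Rle_trans; [apply Rabs_triang |].
  rewrite !Rabs_mult, (Rabs_pos_eq l), (Rabs_pos_eq (1 - r ^ 2)),
    (Rabs_pos_eq (/ p)), (Rabs_pos_eq r)
    by (try lra; try (left; apply Rinv_0_lt_compat; lra); nra).
  assert (ha : / p * Rabs (g * p - 1) <= M' * (M * (2 * z))).
  { apply Rmult_le_compat; [left; apply Rinv_0_lt_compat; lra
                           | apply Rabs_pos | easy | easy]. }
  assert (hb : 0 <= / p * Rabs (g * p - 1)).
  { apply Rmult_le_pos; [left; apply Rinv_0_lt_compat; lra | apply Rabs_pos]. }
  assert (hc : l * (1 - r ^ 2) * (/ p * Rabs (g * p - 1))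
               <= l * (M' * (M * (2 * z)))).
  { assert (hr2 : 0 <= 1 - r ^ 2 <= 1) by (simpl; nra).
    apply Rmult_le_compat; [apply Rmult_le_pos; lra | easy | | easy].
    rewrite <- (Rmult_1_r l) at 2; apply Rmult_le_compat_l; lra. }
  assert (r * Rabs e <= 2 * z) by (pose proof (Rabs_pos e); nra).
  lra.
Qed.

Lemma geg_tail_lim (l r : R) :
  0 < l -> 0 <= r < 1 -> is_lim_seq (geg_tail l r) 0.
Proof.
intros hl hr.
(* The ratio test needs nonzero terms, which fails at r = 0; the comparison value s satisfies r < s
   < 1 and is positive. *)
set (s := (1 + r) / 2).
assert (hs : r < s < 1) by (unfold s; lra).
apply (is_lim_seq_le_le (fun _ => 0) _ (geg_tail l s)).
- intros N; split; [now apply geg_tail_nonneg |].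
  unfold geg_tail; apply Rmult_le_compat_l; [| apply pow_incr; lra].
  pose proof (geg_at_1_pos l (S N) hl); pose proof (pos_INR N); nra.
- apply is_lim_seq_const.
- assert (hpos : forall N, 0 < geg_tail l s N).
  { intros N; unfold geg_tail.
    pose proof (geg_at_1_pos l (S N) hl); pose proof (pos_INR N).
    pose proof (pow_lt s N ltac:(lra)).
    apply Rmult_lt_0_compat; nra. }
  assert (hser : ex_series (fun N => Rabs (geg_tail l s N))).
  { apply (ex_series_DAlembert _ s); [easy | intros N; specialize (hpos N); lra |].
    apply (is_lim_seq_ext (fun N => s * (1 + 2 * l * / (INR N + 1)))).
    - intros N; pose proof (pos_INR N).
      pose proof (geg_at_1_pos l (S N) hl); pose proof (pow_lt s N ltac:(lra)).
      rewrite Rabs_pos_eq by (left; apply Rdiv_lt_0_compat; apply hpos).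
      pose proof (geg_at_1 l (S N)) as h1.
      unfold geg_tail; rewrite h1, S_INR; simpl; field; lra.
    - replace (Finite s) with (Rbar_mult s (Rbar_plus 1 (Rbar_mult (2 * l) 0)))
        by (simpl; f_equal; ring).
      apply is_lim_seq_scal_l, is_lim_seq_plus'; [apply is_lim_seq_const |].
      apply (is_lim_seq_scal_l (fun N => / (INR N + 1)) (2 * l) 0).
      apply (is_lim_seq_ext (fun N => / INR (S N)));
        [intros; now rewrite S_INR |].
      apply (is_lim_seq_inv (fun N => INR (S N)) p_infty); [| easy].
      apply (is_lim_seq_incr_1 INR), is_lim_seq_INR. }
  apply ex_series_lim_0.
  apply (ex_series_ext (fun N => Rabs (geg_tail l s N))); [| exact hser].
  intros N; apply Rabs_pos_eq, Rlt_le, hpos.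
Qed.

(** * Continuous functions *)

(** Continuity on the whole line is stable under composition without side conditions, so
    [solve_cont] can follow the syntax. *)
Definition cont (f : R -> R) : Prop := forall x, continuous f x.

Lemma cont_const (c : R) : cont (fun _ => c).
Proof. intros x; apply continuous_const. Qed.

Lemma cont_id : cont (fun x => x).
Proof. intros x; apply continuous_id. Qed.

Lemma cont_plus (f g : R -> R) : cont f -> cont g -> cont (fun x => f x + g x).
Proof.
intros hf hg x; now apply (continuous_plus (V := R_NormedModule)).
Qed.

Lemma cont_minus (f g : R -> R) : cont f -> cont g -> cont (fun x => f x - g x).
Proof.
intros hf hg x; now apply (continuous_minus (V := R_NormedModule)).
Qed.

Lemma cont_opp (f : R -> R) : cont f -> cont (fun x => - f x).
Proof. intros hf x; now apply (continuous_opp (V := R_NormedModule)). Qed.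

Lemma cont_mult (f g : R -> R) : cont f -> cont g -> cont (fun x => f x * g x).
Proof.
intros hf hg x; now apply (continuous_mult (K := R_AbsRing)).
Qed.

Lemma cont_comp (f g : R -> R) : cont f -> cont g -> cont (fun x => f (g x)).
Proof. intros hf hg x; now apply (continuous_comp g f). Qed.

Lemma cont_sin : cont sin.
Proof. intros x; apply continuous_sin. Qed.

Lemma cont_cos : cont cos.
Proof. intros x; apply continuous_cos. Qed.

Lemma cont_geg (l : R) (m : nat) : cont (geg l m).
Proof. intros x; apply continuous_geg. Qed.

Lemma cont_rpow (a : R) : 0 < a -> cont (fun x => rpow x a).
Proof. intros ha x; now apply continuous_rpow. Qed.

Lemma cont_abs : cont Rabs.
Proof. intros x; apply continuous_Rabs. Qed.

Ltac solve_cont :=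
  match goal with
  | H : cont ?f |- cont ?f => exact H
  | H : forall n, cont (?f n) |- cont (?f _) => apply H
  | H : forall n, cont (?f n) |- cont (fun x => ?f ?m x) => exact (H m)
  | |- cont (fun _ => ?c) => apply cont_const
  | |- cont (fun x => x) => apply cont_id
  | |- cont sin => apply cont_sin
  | |- cont cos => apply cont_cos
  | |- cont (geg _ _) => apply cont_geg
  | |- cont Rabs => apply cont_abs
  | |- cont (fun x => _ + _) => apply cont_plus; solve_cont
  | |- cont (fun x => _ - _) => apply cont_minus; solve_cont
  | |- cont (fun x => - _) => apply cont_opp; solve_cont
  | |- cont (fun x => _ * _) => apply cont_mult; solve_cont
  | |- cont (fun x => rpow _ ?a) =>
      apply (cont_comp (fun y => rpow y a)); [apply cont_rpow; lra | solve_cont]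
  | |- cont (fun x => ?f x) => change (cont f); solve_cont
  | |- cont (fun x => ?f (@?g x)) => apply (cont_comp f g); solve_cont
  end.

Lemma ex_RInt_cont (f : R -> R) (a b : R) : cont f -> ex_RInt f a b.
Proof.
intros hf; apply (ex_RInt_continuous (V := R_CompleteNormedModule)).
intros z _; apply hf.
Qed.

Lemma RInt_FTC (F f : R -> R) (a b : R) :
  (forall x, is_derive F x (f x)) -> cont f -> RInt f a b = F b - F a.
Proof.
intros hd hc; apply is_RInt_unique.
apply (is_RInt_derive (V := R_CompleteNormedModule)); intros; auto.
Qed.

Lemma is_derive_sin_rpow (a x : R) :
  0 < a ->
  is_derive (fun y => sin y * rpow (Rabs (sin y)) a) x
    (cos x * ((a + 1) * rpow (Rabs (sin x)) a)).
Proof.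
intros ha.
apply (is_derive_comp (V := R_NormedModule)
         (fun z => z * rpow (Rabs z) a) sin).
- now apply is_derive_mul_rpow_abs.
- apply is_derive_Reals, derivable_pt_lim_sin.
Qed.

(** * The Wallis integrals *)

Definition wallis (a : R) : R := RInt (fun x => rpow (Rabs (sin x)) a) 0 PI.

Lemma cont_abs_sin_rpow (a : R) :
  0 < a -> cont (fun x => rpow (Rabs (sin x)) a).
Proof. intros ha; solve_cont. Qed.

Lemma abs_sin_le_1 (x : R) : Rabs (sin x) <= 1.
Proof. apply Rabs_le; pose proof (SIN_bound x); lra. Qed.

Lemma wallis_anti (a b : R) : 0 < a -> a <= b -> wallis b <= wallis a.
Proof.
intros ha hab; apply RInt_le; [left; apply PI_RGT_0 | | |].
- apply ex_RInt_cont, cont_abs_sin_rpow; lra.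
- apply ex_RInt_cont, cont_abs_sin_rpow; lra.
- intros x _; apply rpow_anti; [apply abs_sin_le_1 | easy].
Qed.

Lemma wallis_pos (a : R) : 0 < a -> 0 < wallis a.
Proof.
intros ha; apply RInt_gt_0; [apply PI_RGT_0 | |].
- intros x hx; apply rpow_pos, Rabs_pos_lt.
  assert (0 < sin x) by (apply sin_gt_0; lra); lra.
- intros x _; now apply cont_abs_sin_rpow.
Qed.

(** The primitive cos x sin x |sin x|^a vanishes at 0 and at pi. *)
Lemma wallis_rec (a : R) : 0 < a -> (a + 2) * wallis (a + 2) = (a + 1) * wallis a.
Proof.
intros ha.
set (w := fun x => rpow (Rabs (sin x)) a).
assert (hw : cont w) by now apply cont_abs_sin_rpow.
assert (h0 : RInt (fun x => (a + 1) * w x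
                   - (a + 2) * rpow (Rabs (sin x)) (a + 2)) 0 PI = 0).
{ rewrite (RInt_FTC (fun x => cos x * (sin x * w x))).
  - rewrite sin_0, sin_PI; to_R; ring.
  - intros x.
    replace (rpow (Rabs (sin x)) (a + 2)) with (sin x * sin x * w x).
    2: { replace (a + 2) with (a + 1 + 1) by ring; unfold w.
         rewrite !rpow_succ by apply Rabs_pos.
         rewrite <- (Rabs_pos_eq (sin x * sin x)), Rabs_mult by nra; ring. }
    replace ((a + 1) * w x - (a + 2) * (sin x * sin x * w x))
      with ((- sin x) * (sin x * w x) + cos x * (cos x * ((a + 1) * w x))).
    + apply (is_derive_mult cos (fun x => sin x * w x) x).
      * apply is_derive_Reals, derivable_pt_lim_cos.
      * now apply is_derive_sin_rpow.
      * intros; apply Rmult_comm.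
    + pose proof (sin2_cos2 x) as h; unfold Rsqr in h.
      replace (cos x * (cos x * ((a + 1) * w x)))
        with ((cos x * cos x) * ((a + 1) * w x)) by ring.
      replace (cos x * cos x) with (1 - sin x * sin x) by lra; ring.
  - solve_cont. }
assert (h1 : RInt (fun x => (a + 1) * w x
                   - (a + 2) * rpow (Rabs (sin x)) (a + 2)) 0 PI
             = (a + 1) * wallis a - (a + 2) * wallis (a + 2)).
{ apply is_RInt_unique.
  apply (is_RInt_minus (V := R_NormedModule)).
  - apply (is_RInt_scal (V := R_NormedModule)).
    apply (RInt_correct (V := R_CompleteNormedModule)), ex_RInt_cont, hw.
  - apply (is_RInt_scal (V := R_NormedModule)).
    apply (RInt_correct (V := R_CompleteNormedModule)), ex_RInt_cont.
    apply cont_abs_sin_rpow; lra. }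
rewrite h1 in h0; lra.
Qed.

Lemma wallis_1 : wallis 1 = 2.
Proof.
unfold wallis; rewrite (RInt_ext _ sin).
- rewrite (RInt_FTC (fun x => - cos x)).
  + rewrite cos_0, cos_PI; to_R; ring.
  + intros x; auto_derive; [easy | ring].
  + apply cont_sin.
- intros x; rewrite Rmin_left, Rmax_right by (left; apply PI_RGT_0); intros hx.
  assert (0 < sin x) by (apply sin_gt_0; lra).
  rewrite Rabs_pos_eq, rpow_gt0, Rpower_1 by lra; easy.
Qed.

Lemma wallis_2 : wallis 2 = PI / 2.
Proof.
unfold wallis; rewrite (RInt_ext _ (fun x => sin x * sin x)).
- rewrite (RInt_FTC (fun x => (x - sin x * cos x) / 2)).
  + rewrite sin_0, sin_PI; to_R; field.
  + intros x; auto_derive; [easy |].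
    pose proof (sin2_cos2 x) as h; unfold Rsqr in h; lra.
  + solve_cont.
- intros x; rewrite Rmin_left, Rmax_right by (left; apply PI_RGT_0); intros hx.
  assert (0 < sin x) by (apply sin_gt_0; lra).
  replace 2 with (0 + 1 + 1) by ring.
  rewrite Rabs_pos_eq, !rpow_succ, rpow_gt0, Rpower_O by lra; to_R; ring.
Qed.

Lemma wallis_product_shift (a : R) (n : nat) :
  0 < a ->
  (a + INR n + 1) * wallis (a + INR n + 1) * wallis (a + INR n)
  = (a + 1) * wallis (a + 1) * wallis a.
Proof.
intros ha; induction n as [|n IH]; [simpl; now rewrite Rplus_0_r |].
rewrite <- IH, S_INR; pose proof (pos_INR n).
pose proof (wallis_rec (a + INR n) ltac:(lra)) as h.
replace (a + (INR n + 1)) with (a + INR n + 1) by ring.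
replace (a + INR n + 1 + 1) with (a + INR n + 2) by ring.
rewrite h; ring.
Qed.

(* The product is invariant under [a -> a + 1] and known at integers; since
   [wallis] is decreasing, it is squeezed between its values at the two
   neighbouring integers, after an arbitrarily large shift. *)
Lemma wallis_product (a : R) :
  0 < a -> (a + 1) * wallis (a + 1) * wallis a = 2 * PI.
Proof.
intros ha.
set (P := (a + 1) * wallis (a + 1) * wallis a).
assert (hint : forall n, (INR n + 2) * wallis (INR n + 2) * wallis (INR n + 1)
                         = 2 * PI).
{ intros n; pose proof (wallis_product_shift 1 n ltac:(lra)) as h.
  replace (1 + INR n + 1) with (INR n + 2) in h by ring.
  replace (1 + INR n) with (INR n + 1) in h by ring.
  rewrite h; replace (1 + 1) with 2 by ring; rewrite wallis_1, wallis_2; field. }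
destruct (nfloor_ex a ltac:(lra)) as [n0 hn0].
assert (hb : forall N, Rabs (P - 2 * PI) <= 2 * PI * / INR (S N)).
{ intros N.
  pose proof (wallis_product_shift a (S N) ha) as h; fold P in h.
  set (b := a + INR (S N)) in h; set (j := (n0 + N)%nat).
  assert (hj : INR j + 1 <= b < INR j + 2)
    by (unfold j, b; rewrite plus_INR, S_INR; lra).
  pose proof (hint j) as h1; pose proof (hint (S j)) as h2.
  rewrite S_INR in h2.
  replace (INR j + 1 + 2) with (INR j + 3) in h2 by ring.
  replace (INR j + 1 + 1) with (INR j + 2) in h2 by ring.
  pose proof (pos_INR j) as hj0.
  pose proof (wallis_anti (INR j + 1) b ltac:(lra) ltac:(lra)) as a1.
  pose proof (wallis_anti (INR j + 2) (b + 1) ltac:(lra) ltac:(lra)) as a2.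
  pose proof (wallis_anti b (INR j + 2) ltac:(lra) ltac:(lra)) as a3.
  pose proof (wallis_anti (b + 1) (INR j + 3) ltac:(lra) ltac:(lra)) as a4.
  pose proof (wallis_pos (INR j + 3) ltac:(lra)) as p3.
  pose proof (wallis_pos (INR j + 2) ltac:(lra)) as p2.
  set (w := wallis (b + 1) * wallis b).
  assert (hP : P = (b + 1) * w) by (rewrite <- h; unfold w; ring).
  assert (hup : w <= wallis (INR j + 2) * wallis (INR j + 1))
    by (apply Rmult_le_compat; lra).
  assert (hlo : wallis (INR j + 3) * wallis (INR j + 2) <= w)
    by (apply Rmult_le_compat; lra).
  pose proof PI_RGT_0 as hpi.
  assert (h1' : (INR j + 2) * w <= 2 * PI) by nra.
  assert (h2' : 2 * PI <= (INR j + 3) * w) by nra.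
  assert (hw : 0 < w) by nra.
  assert (hsm : w <= 2 * PI * / INR (S N)).
  { apply (Rmult_le_reg_l (INR (S N))); [apply lt_0_INR; lia |].
    replace (INR (S N) * (2 * PI * / INR (S N))) with (2 * PI)
      by (field; apply not_0_INR; lia).
    assert (INR (S N) <= INR j + 2)
      by (unfold j; rewrite plus_INR, S_INR; pose proof (pos_INR n0); lra).
    nra. }
  (* Both P = (b + 1) w and 2 pi lie between (j + 2) w and (j + 3) w, so they differ by at most
     w. *)
  apply Rle_trans with w; [| easy].
  rewrite hP; apply Rabs_le; nra. }
assert (hlim : is_lim_seq (fun N => 2 * PI * / INR (S N)) 0).
{ replace (Finite 0) with (Rbar_mult (2 * PI) 0) by (simpl; f_equal; ring).
  apply (is_lim_seq_scal_l (fun N => / INR (S N)) (2 * PI) 0).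
  apply (is_lim_seq_inv (fun N => INR (S N)) p_infty); [| easy].
  apply (is_lim_seq_incr_1 INR), is_lim_seq_INR. }
pose proof (is_lim_seq_le _ _ (Rabs (P - 2 * PI)) 0 hb
              (is_lim_seq_const _) hlim) as h; simpl in h.
destruct (Req_dec (P - 2 * PI) 0) as [e | e]; [lra |].
apply Rabs_pos_lt in e; lra.
Qed.

(** Substitution u = - cos x, which is increasing on [0, pi]; its derivative supplies the extra
    power of the sine. *)
Lemma beta_int_wallis (l : R) : 0 < l -> beta_int l = wallis (2 * l + 1).
Proof.
intros hl; unfold beta_int, wallis.
pose proof (RInt_comp (V := R_CompleteNormedModule)
  (fun u => rpow (1 - u ^ 2) l) (fun x => - cos x) sin 0 PI) as h.
cbv beta in h.
replace (- cos 0) with (-1) in h by (rewrite cos_0; ring).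
replace (- cos PI) with 1 in h by (rewrite cos_PI; ring).
rewrite <- h.
- apply RInt_ext; intros x.
  rewrite Rmin_left, Rmax_right by (left; apply PI_RGT_0); intros hx.
  assert (hs : 0 < sin x) by (apply sin_gt_0; lra).
  change (sin x * rpow (1 - (- cos x) ^ 2) l = rpow (Rabs (sin x)) (2 * l + 1)).
  rewrite Rabs_pos_eq, rpow_succ by lra; f_equal.
  pose proof (sin2_cos2 x) as h2; unfold Rsqr in h2.
  replace (1 - (- cos x) ^ 2) with (sin x * sin x) by (simpl; lra).
  rewrite !rpow_gt0 by nra; unfold Rpower; rewrite ln_mult by easy.
  f_equal; ring.
- intros; now apply continuous_rpow_ends.
- intros x _; split; [| apply cont_sin].
  auto_derive; [easy | ring].
Qed.

(** * Integration against |sin x|^(2 l) *)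

Definition Lam (l : R) (f : R -> R) : R := RInt (fun x => f x * wk l x) (-PI) PI.

Lemma cont_wk (l : R) : 0 < l -> cont (wk l).
Proof. intros hl; unfold wk; solve_cont. Qed.

Lemma Lam_ext (l : R) (f g : R -> R) : (forall x, f x = g x) -> Lam l f = Lam l g.
Proof. intros h; apply RInt_ext; intros; now rewrite h. Qed.

Lemma Lam_plus (l : R) (f g : R -> R) :
  0 < l -> cont f -> cont g -> Lam l (fun x => f x + g x) = Lam l f + Lam l g.
Proof.
intros hl hf hg; pose proof (cont_wk l hl).
unfold Lam; rewrite <- (RInt_plus (V := R_CompleteNormedModule))
  by (apply ex_RInt_cont; solve_cont).
apply RInt_ext; intros x _; apply Rmult_plus_distr_r.
Qed.

Lemma Lam_scal (l c : R) (f : R -> R) :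
  0 < l -> cont f -> Lam l (fun x => c * f x) = c * Lam l f.
Proof.
intros hl hf; pose proof (cont_wk l hl).
unfold Lam; rewrite <- (RInt_scal (V := R_CompleteNormedModule) _ _ _ c)
  by (apply ex_RInt_cont; solve_cont).
apply RInt_ext; intros x _; apply Rmult_assoc.
Qed.

Lemma Lam_odd (l : R) (f : R -> R) :
  0 < l -> cont f -> (forall x, f (- x) = - f x) -> Lam l f = 0.
Proof.
intros hl hf ho; pose proof (cont_wk l hl).
assert (h : Lam l f = - Lam l f); [| lra].
unfold Lam at 1.
pose proof (RInt_comp_lin (V := R_CompleteNormedModule)
  (fun x => f x * wk l x) (-1) 0 (-PI) PI) as h.
replace (-1 * - PI + 0) with PI in h by ring.
replace (-1 * PI + 0) with (- PI) in h by ring.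
specialize (h ltac:(apply ex_RInt_cont; solve_cont)).
rewrite <- (opp_RInt_swap (V := R_CompleteNormedModule) _ (- PI) PI) in h
  by (apply ex_RInt_cont; solve_cont).
unfold Lam; etransitivity; [| exact h]; apply RInt_ext; intros x _.
change (f x * wk l x = -1 * (f (-1 * x + 0) * wk l (-1 * x + 0))).
replace (-1 * x + 0) with (- x) by ring.
unfold wk; rewrite ho, sin_neg, Rabs_Ropp; ring.
Qed.

Lemma Lam_const_1 (l : R) : 0 < l -> Lam l (fun _ => 1) = 2 * wallis (2 * l).
Proof.
intros hl; pose proof (cont_wk l hl) as hw.
unfold Lam, wallis.
rewrite <- (RInt_Chasles (V := R_CompleteNormedModule) _ (-PI) 0 PI)
  by (apply ex_RInt_cont; solve_cont).
pose proof (RInt_comp_lin (V := R_CompleteNormedModule) (wk l) (-1) 0 (-PI) 0)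
  as h.
replace (-1 * - PI + 0) with PI in h by ring.
replace (-1 * 0 + 0) with 0 in h by ring.
specialize (h (ex_RInt_cont _ _ _ hw)).
rewrite <- (opp_RInt_swap (V := R_CompleteNormedModule) _ 0 PI) in h
  by now apply ex_RInt_cont.
assert (h1 : RInt (fun x => 1 * wk l x) (- PI) 0 = RInt (wk l) 0 PI).
{ assert (h2 : RInt (fun x => -1 * (1 * wk l x)) (- PI) 0 = - RInt (wk l) 0 PI).
  { etransitivity; [| exact h]; apply RInt_ext; intros x _.
    change (-1 * (1 * wk l x) = -1 * wk l (-1 * x + 0)).
    replace (-1 * x + 0) with (- x) by ring.
    unfold wk; rewrite sin_neg, Rabs_Ropp; ring. }
  pose proof (RInt_scal (V := R_CompleteNormedModule)
    (fun x => 1 * wk l x) (- PI) 0 (-1)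
    ltac:(apply ex_RInt_cont; solve_cont)) as h3.
  change (RInt (fun x => -1 * (1 * wk l x)) (- PI) 0
          = -1 * RInt (fun x => 1 * wk l x) (- PI) 0) in h3.
  rewrite h2 in h3; lra. }
assert (h4 : RInt (fun x => 1 * wk l x) 0 PI = RInt (wk l) 0 PI)
  by (apply RInt_ext; intros; apply Rmult_1_l).
rewrite h1, h4; apply Rplus_diag.
Qed.

(** The Wallis product at a = 2 l links the total masses of the weight in u and of the weight in
    x. *)
Lemma Bt_Lam_const (l : R) : 0 < l -> l * Bt l * Lam l (fun _ => 1) = 2 * PI.
Proof.
intros hl; rewrite Lam_const_1 by easy; unfold Bt; rewrite beta_int_wallis by easy.
rewrite <- (wallis_product (2 * l)) by lra; field; lra.
Qed.

Lemma RInt_pos_of_point (f : R -> R) (a b y : R) :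
  cont f -> (forall x, 0 <= f x) -> a < y < b -> 0 < f y -> 0 < RInt f a b.
Proof.
intros hc hf hy hfy.
destruct (proj1 (filterlim_locally _ _) (hc y) (mkposreal _ hfy)) as [d hd].
set (e := Rmin (d / 2) (Rmin (y - a) (b - y))).
pose proof (cond_pos d) as hdp.
assert (he : 0 < e) by (unfold e; repeat apply Rmin_pos; lra).
assert (h1 : e <= d / 2) by apply Rmin_l.
assert (h2 : e <= y - a) by (eapply Rle_trans; [apply Rmin_r | apply Rmin_l]).
assert (h3 : e <= b - y) by (eapply Rle_trans; [apply Rmin_r | apply Rmin_r]).
rewrite <- (RInt_Chasles (V := R_CompleteNormedModule) f a (y - e) b),
  <- (RInt_Chasles (V := R_CompleteNormedModule) f (y - e) (y + e) b)
  by now apply ex_RInt_cont.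
assert (i1 : 0 <= RInt f a (y - e))
  by (apply RInt_ge_0; [lra | now apply ex_RInt_cont | auto]).
assert (i2 : 0 <= RInt f (y + e) b)
  by (apply RInt_ge_0; [lra | now apply ex_RInt_cont | auto]).
assert (i3 : 0 < RInt f (y - e) (y + e)).
{ apply RInt_gt_0; [lra | | auto].
  intros x hx; specialize (hd x).
  assert (hb : ball y d x).
  { change (Rabs (x - y) < d); apply Rabs_def1; lra. }
  specialize (hd hb); change (Rabs (f x - f y) < f y) in hd.
  apply Rabs_def2 in hd; lra. }
change plus with Rplus; simpl; lra.
Qed.

(** The weight vanishes at multiples of pi, so x is first moved, within the neighbourhood where f >
    0, to an interior point with nonzero sine. *)
Lemma Lam_pos_of_point (l : R) (f : R -> R) (x : R) :
  0 < l -> cont f -> (forall y, 0 <= f y) -> - PI <= x <= PI -> 0 < f x ->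
  0 < Lam l f.
Proof.
intros hl hc hf hx hfx; pose proof (cont_wk l hl) as hw.
assert (hy : exists y, -PI < y < PI /\ sin y <> 0 /\ 0 < f y).
{ destruct (proj1 (filterlim_locally _ _) (hc x) (mkposreal _ hfx)) as [d hd].
  pose proof (cond_pos d) as hdp; pose proof PI_RGT_0 as hpi.
  set (e := Rmin (d / 2) (PI / 2)).
  assert (he : 0 < e) by (apply Rmin_pos; lra).
  assert (h1 : e <= d / 2) by apply Rmin_l.
  assert (h2 : e <= PI / 2) by apply Rmin_r.
  assert (hfy : forall y, Rabs (y - x) < d -> 0 < f y).
  { intros y hyd; specialize (hd y hyd).
    change (Rabs (f y - f x) < f x) in hd; apply Rabs_def2 in hd; lra. }
  assert (hsp : forall y, 0 < y < PI -> sin y <> 0)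
    by (intros y hy; assert (0 < sin y) by (apply sin_gt_0; lra); lra).
  assert (hsn : forall y, - PI < y < 0 -> sin y <> 0).
  { intros y hy; assert (0 < sin (- y)) by (apply sin_gt_0; lra).
    rewrite sin_neg in *; lra. }
  destruct (Rle_dec x (- PI)); [| destruct (Rlt_dec x 0);
    [| destruct (Rle_dec x 0); [| destruct (Rlt_dec x PI)]]].
  - exists (x + e); repeat split; [lra | lra | apply hsn; lra |].
    apply hfy, Rabs_def1; lra.
  - exists x; repeat split; [lra | lra | apply hsn; lra | easy].
  - exists (x + e); repeat split; [lra | lra | apply hsp; lra |].
    apply hfy, Rabs_def1; lra.
  - exists x; repeat split; [lra | lra | apply hsp; lra | easy].
  - exists (x - e); repeat split; [lra | lra | apply hsp; lra |].
    apply hfy, Rabs_def1; lra. }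
destruct hy as [y [hy [hs hfy]]].
apply (RInt_pos_of_point _ _ _ y); [solve_cont | | easy |].
- intros z; apply Rmult_le_pos; [apply hf | apply rpow_nonneg].
- apply Rmult_lt_0_compat; [easy |]; now apply rpow_pos, Rabs_pos_lt.
Qed.

(** Integrates the derivative of sin x |sin x|^(2l) h(x), which vanishes at both ends. All means and
    orthogonality relations below start from this. *)
Lemma Lam_parts (l : R) (h dh : R -> R) :
  0 < l -> (forall x, is_derive h x (dh x)) -> cont dh ->
  Lam l (fun x => sin x * dh x + (2 * l + 1) * (cos x * h x)) = 0.
Proof.
intros hl hd hc; pose proof (cont_wk l hl) as hw.
assert (hh : cont h).
{ intros x; apply (ex_derive_continuous (V := R_NormedModule)); eexists; apply hd. }
unfold Lam; rewrite (RInt_FTC (fun x => (sin x * wk l x) * h x)).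
- rewrite sin_neg, sin_PI; to_R; ring.
- intros x.
  replace ((sin x * dh x + (2 * l + 1) * (cos x * h x)) * wk l x)
    with ((cos x * ((2 * l + 1) * wk l x)) * h x + (sin x * wk l x) * dh x)
    by ring.
  apply (is_derive_mult (fun x => sin x * wk l x) h x).
  + apply is_derive_sin_rpow; lra.
  + apply hd.
  + intros; apply Rmult_comm.
- solve_cont.
Qed.

(** * Orthogonality and norms of the Gegenbauer polynomials *)

Lemma is_derive_geg_cos (l x : R) (m : nat) :
  is_derive (fun y => geg l (S m) (cos y)) x
    (- sin x * (2 * l * geg (l + 1) m (cos x))).
Proof.
apply (is_derive_comp (V := R_NormedModule) (geg l (S m)) cos).
- apply is_derive_geg.
- apply is_derive_Reals, derivable_pt_lim_cos.
Qed.

Lemma cos_mul_geg (l t : R) (m : nat) :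
  0 < l ->
  t * geg l (S m) t =
  (INR m + 2) / (2 * (INR m + 1 + l)) * geg l (S (S m)) t
  + (INR m + 2 * l) / (2 * (INR m + 1 + l)) * geg l m t.
Proof.
intros hl; pose proof (pos_INR m); rewrite geg_SS; field; lra.
Qed.

(** [Lam_parts] with h = C_{m+1}(cos x), reduced to degrees m and m + 2 by [geg_contiguous] and the
    recurrence. *)
Lemma Lam_geg_rec (l : R) (m : nat) :
  0 < l ->
  (INR m + 2 + 2 * l) * (INR m + 2) * Lam l (fun x => geg l (S (S m)) (cos x))
  = INR m * (INR m + 2 * l) * Lam l (fun x => geg l m (cos x)).
Proof.
intros hl; pose proof (pos_INR m) as hm.
pose proof (Lam_parts l (fun y => geg l (S m) (cos y)) _ hl
  (fun x => is_derive_geg_cos l x m) ltac:(solve_cont)) as h.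
simpl in h.
rewrite (Lam_ext _ _ (fun x =>
  (INR m + 2 + 2 * l) * (INR m + 2) / (2 * (INR m + 1 + l))
    * geg l (S (S m)) (cos x)
  + - (INR m * (INR m + 2 * l) / (2 * (INR m + 1 + l)))
    * geg l m (cos x))) in h.
- rewrite Lam_plus, !Lam_scal in h by (easy || solve_cont).
  apply (Rmult_eq_reg_l (/ (2 * (INR m + 1 + l))));
    [| apply Rinv_neq_0_compat; lra].
  unfold Rdiv in h; lra.
- intros x.
  pose proof (geg_contiguous l (cos x) m) as hc.
  pose proof (sin2_cos2 x) as hs; unfold Rsqr in hs.
  replace (sin x * (- sin x * (2 * l * geg (l + 1) m (cos x))))
    with (- ((sin x * sin x) * (2 * l * geg (l + 1) m (cos x)))) by ring.
  replace (sin x * sin x) with (1 - cos x * cos x) by lra.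
  rewrite hc, cos_mul_geg by easy; field; lra.
Qed.

(** Degree 1 comes from [Lam_parts] with h = 1, degree 2 from the factor m = 0 on the right of
    [Lam_geg_rec]; that recursion then propagates by steps of two. *)
Lemma Lam_geg_0 (l : R) (m : nat) :
  0 < l -> Lam l (fun x => geg l (S m) (cos x)) = 0.
Proof.
intros hl; revert m; apply nat_ind2.
- pose proof (Lam_parts l (fun _ => 1) (fun _ => 0) hl
    (fun x => is_derive_const (V := R_NormedModule) 1 x) (cont_const 0)) as h.
  rewrite (Lam_ext _ _ (fun x => (2 * l + 1) / (2 * l) * geg l 1 (cos x))) in h
    by (intros x; rewrite geg_1; field; lra).
  rewrite Lam_scal in h by (easy || solve_cont).
  apply Rmult_integral in h; destruct h as [h | h]; [| easy].
  exfalso; revert h; apply Rgt_not_eq, Rdiv_lt_0_compat; lra.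
- pose proof (Lam_geg_rec l 0 hl) as h; simpl in h |- *; nra.
- intros m IH _; pose proof (Lam_geg_rec l (S m) hl) as h.
  rewrite IH, Rmult_0_r in h; pose proof (pos_INR (S m)).
  apply Rmult_integral in h; destruct h as [h | h]; [| easy].
  exfalso; revert h; apply Rgt_not_eq, Rmult_lt_0_compat; lra.
Qed.

(** Stated for any family obeying a three-term recurrence in cos x, since it serves three: C_j^l(cos
    x), cos(j x), and sin((j + 1) x) / sin x. *)
Lemma Lam_geg_orth (l : R) (phi : nat -> R -> R) (a b : nat -> R) (e : R) :
  0 < l -> (forall j, cont (phi j)) ->
  (forall x, phi 0%nat x = 1) -> (forall x, phi 1%nat x = e * cos x) ->
  (forall j x, phi (S (S j)) x = a j * (cos x * phi (S j) x) - b j * phi j x) ->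
  forall j m, (j < m)%nat -> Lam l (fun x => geg l m (cos x) * phi j x) = 0.
Proof.
intros hl hc h0 h1 hr.
(* Multiplying C_m by cos x gives degrees m - 1 and m + 1, both still above j when j + 1 < m. *)
assert (hstep : forall j,
  (forall m, (j < m)%nat -> Lam l (fun x => geg l m (cos x) * phi j x) = 0) ->
  forall m, (S j < m)%nat ->
  Lam l (fun x => cos x * (geg l m (cos x) * phi j x)) = 0).
{ intros j IH m hm; destruct m as [|m]; [lia |].
  rewrite (Lam_ext _ _ (fun x =>
    (INR m + 2) / (2 * (INR m + 1 + l))
      * (geg l (S (S m)) (cos x) * phi j x)
    + (INR m + 2 * l) / (2 * (INR m + 1 + l))
      * (geg l m (cos x) * phi j x))).
  - rewrite Lam_plus, !Lam_scal, !IH by (easy || lia || solve_cont); ring.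
  - intros x; rewrite <- Rmult_assoc, cos_mul_geg by easy; ring. }
apply (nat_ind2 (fun j => forall m, (j < m)%nat ->
  Lam l (fun x => geg l m (cos x) * phi j x) = 0)).
- intros [|m] hm; [lia |].
  rewrite (Lam_ext _ _ (fun x => geg l (S m) (cos x)))
    by (intros; rewrite h0; ring).
  now apply Lam_geg_0.
- intros m hm.
  rewrite (Lam_ext _ _ (fun x => e * (cos x * (geg l m (cos x) * phi 0%nat x))))
    by (intros; rewrite h0, h1; ring).
  rewrite Lam_scal, hstep; [ring | | easy | easy | solve_cont].
  intros [|p] hp; [lia |].
  rewrite (Lam_ext _ _ (fun x => geg l (S p) (cos x)))
    by (intros; rewrite h0; ring).
  now apply Lam_geg_0.
- intros j IH0 IH1 m hm.
  rewrite (Lam_ext _ _ (fun x =>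
    a j * (cos x * (geg l m (cos x) * phi (S j) x))
    + - b j * (geg l m (cos x) * phi j x)))
    by (intros; rewrite hr; ring).
  rewrite Lam_plus, !Lam_scal, hstep, IH0
    by (easy || lia || solve_cont); ring.
Qed.

Lemma Lam_geg_geg (l : R) (j m : nat) :
  0 < l -> (j < m)%nat -> Lam l (fun x => geg l m (cos x) * geg l j (cos x)) = 0.
Proof.
intros hl; apply (Lam_geg_orth l (fun j x => geg l j (cos x))
  (fun j => 2 * (INR j + 1 + l) / (INR j + 2))
  (fun j => (INR j + 2 * l) / (INR j + 2)) (2 * l)); [easy | | easy | easy |].
- intros i; solve_cont.
- intros i x; now rewrite geg_SS.
Qed.

Definition gnorm (l : R) (m : nat) : R := Lam l (fun x => geg l m (cos x) ^ 2).

(** The integral c of cos x C_{m+1} C_m is computed twice, by expanding cos x C_m and by expanding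
    cos x C_{m+1}; orthogonality leaves a single norm each time. *)
Lemma gnorm_rec (l : R) (m : nat) :
  0 < l ->
  (INR m + 1) * (INR m + 1 + l) * gnorm l (S m)
  = (INR m + l) * (INR m + 2 * l) * gnorm l m.
Proof.
intros hl; pose proof (pos_INR m) as hm.
set (c := Lam l (fun x => cos x * geg l (S m) (cos x) * geg l m (cos x))).
assert (h1 : (INR m + 1) * gnorm l (S m) = 2 * (INR m + l) * c).
{ unfold gnorm, c; rewrite <- !Lam_scal by (easy || (simpl; solve_cont)).
  destruct m as [|m].
  - apply Lam_ext; intros x; rewrite geg_1, geg_0; simpl; ring.
  - rewrite S_INR in *.
    rewrite (Lam_ext _ _ (fun x =>
      2 * (INR m + 1 + l) * (cos x * geg l (S (S m)) (cos x) * geg l (S m) (cos x))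
      + - (INR m + 2 * l) * (geg l (S (S m)) (cos x) * geg l m (cos x)))).
    + rewrite Lam_plus, (Lam_scal _ (- _)), (Lam_geg_geg l m)
        by (easy || lia || solve_cont); ring.
    + intros x; pose proof (geg_rec l (cos x) m) as h.
      replace ((INR m + 1 + 1) * geg l (S (S m)) (cos x) ^ 2)
        with (((INR m + 2) * geg l (S (S m)) (cos x)) * geg l (S (S m)) (cos x))
        by ring.
      rewrite h; ring. }
assert (h2 : c = (INR m + 2 * l) / (2 * (INR m + 1 + l)) * gnorm l m).
{ unfold gnorm, c.
  rewrite (Lam_ext _ _ (fun x =>
    (INR m + 2) / (2 * (INR m + 1 + l))
      * (geg l (S (S m)) (cos x) * geg l m (cos x))
    + (INR m + 2 * l) / (2 * (INR m + 1 + l)) * geg l m (cos x) ^ 2)).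
  - rewrite Lam_plus, !Lam_scal, Lam_geg_geg
      by (easy || lia || (simpl; solve_cont)); ring.
  - intros x; rewrite cos_mul_geg by easy; ring. }
replace ((INR m + 1) * (INR m + 1 + l) * gnorm l (S m))
  with ((INR m + 1 + l) * ((INR m + 1) * gnorm l (S m))) by ring.
rewrite h1, h2; field; lra.
Qed.

(** The left side does not depend on m: [gnorm_rec] and [kap_S] compensate. At m = 0 it is
    [Bt_Lam_const]. This is the source of the factor (m + k) / (2 pi). *)
Lemma gnorm_kap (l : R) (m : nat) :
  0 < l -> (INR m + l) * kap l m * gnorm l m = 2 * PI.
Proof.
intros hl; induction m as [|m IH].
- rewrite <- (Bt_Lam_const l hl); unfold kap, gnorm; rewrite geg_0.
  rewrite (Lam_ext _ _ (fun _ => 1)) by (intros; rewrite geg_0; ring).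
  simpl; field.
- rewrite <- IH, kap_S, S_INR by easy; pose proof (pos_INR m).
  transitivity (kap l m / (INR m + 2 * l)
    * ((INR m + 1) * (INR m + 1 + l) * gnorm l (S m))); [field; lra |].
  rewrite gnorm_rec by easy; field; lra.
Qed.

Lemma gnorm_pos (l : R) (m : nat) : 0 < l -> 0 < gnorm l m.
Proof.
intros hl; unfold gnorm; pose proof PI_RGT_0.
apply (Lam_pos_of_point l _ 0); [easy | simpl; solve_cont | | lra |].
- intros y; apply pow2_ge_0.
- rewrite cos_0; apply pow_lt; now apply geg_at_1_pos.
Qed.

(** * Trigonometric polynomials *)

Notation expz j := (fun x : R => cexpi (IZR j * x)).

(* Exponents of the same parity as [M] and absolute value at most [M]; the
   exponents strictly below [e^{iMx}] are those of [lowexp (M - 2)]. *)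
Definition lowexp (M j : Z) : Prop := exists i : Z, (0 <= i /\ M - Z.abs j = 2 * i)%Z.

(** An inductive predicate avoids coefficient families; [span_ext] closes it under pointwise
    equality, so no extensionality is invoked. *)
Inductive span (P : Z -> Prop) : (R -> C) -> Prop :=
| span_exp j : P j -> span P (expz j)
| span_zero : span P (fun _ => RtoC 0)
| span_plus f g : span P f -> span P g -> span P (fun x => (f x + g x)%C)
| span_scal (c : C) f : span P f -> span P (fun x => (c * f x)%C)
| span_ext f g : (forall x, f x = g x) -> span P f -> span P g.

Lemma span_mono (P Q : Z -> Prop) (f : R -> C) :
  (forall j, P j -> Q j) -> span P f -> span Q f.
Proof.
intros h; induction 1.
- now apply span_exp, h.
- apply span_zero.
- now apply span_plus.
- now apply span_scal.
- now apply (span_ext Q f).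
Qed.

Lemma span_minus (P : Z -> Prop) (f g : R -> C) :
  span P f -> span P g -> span P (fun x => (f x - g x)%C).
Proof.
intros hf hg.
apply (span_ext P (fun x => (f x + RtoC (-1) * g x)%C)).
- intros x; apply injective_projections; simpl; ring.
- now apply span_plus, span_scal.
Qed.

Lemma lowexp_le (M j : Z) : lowexp (M - 2) j -> lowexp M j.
Proof. intros [i hi]; exists (i + 1)%Z; lia. Qed.

Lemma cos_cexpi (j : Z) (x : R) :
  (RtoC (cos x) * cexpi (IZR j * x))%C
  = (RtoC (/ 2) * cexpi (IZR (j + 1) * x)
     + RtoC (/ 2) * cexpi (IZR (j - 1) * x))%C.
Proof.
rewrite plus_IZR, minus_IZR.
replace ((IZR j + 1) * x) with (IZR j * x + x) by ring.
replace ((IZR j - 1) * x) with (IZR j * x - x) by ring.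
unfold cexpi; apply injective_projections; simpl.
- rewrite cos_plus, cos_minus; field.
- rewrite sin_plus, sin_minus; field.
Qed.

Lemma span_cos (M : Z) (f : R -> C) :
  span (lowexp M) f -> span (lowexp (M + 1)) (fun x => (RtoC (cos x) * f x)%C).
Proof.
induction 1 as [j [i hi] | | f g _ IHf _ IHg | c f _ IH | f g e _ IH].
- apply (span_ext _ (fun x => (RtoC (/ 2) * cexpi (IZR (j + 1) * x)
     + RtoC (/ 2) * cexpi (IZR (j - 1) * x))%C)).
  { intros x; now rewrite cos_cexpi. }
  assert (h : forall j', (Z.abs j' = Z.abs j + 1 \/ Z.abs j' = Z.abs j - 1)%Z ->
                         lowexp (M + 1) j').
  { intros j' [e | e]; [exists i | exists (i + 1)%Z]; lia. }
  apply span_plus; apply span_scal; apply (span_exp (lowexp (M + 1)));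
    apply h; lia.
- apply (span_ext _ (fun _ => RtoC 0)); [| apply span_zero].
  intros x; apply injective_projections; simpl; ring.
- eapply span_ext; [| exact (span_plus _ _ _ IHf IHg)].
  intros x; apply injective_projections; simpl; ring.
- eapply span_ext; [| exact (span_scal _ c _ IH)].
  intros x; apply injective_projections; simpl; ring.
- eapply span_ext; [| exact IH]; intros x; simpl; now rewrite e.
Qed.

Definition lead (M : Z) (f : R -> C) (p q : C) : Prop :=
  exists g, span (lowexp (M - 2)) g /\
    forall x, f x = (p * cexpi (IZR M * x) + q * cexpi (IZR (- M) * x) + g x)%C.

Lemma lead_span (M : Z) (f : R -> C) (p q : C) :
  (0 <= M)%Z -> lead M f p q -> span (lowexp M) f.
Proof.
intros hM [g [hg e]].
eapply span_ext; [intros x; symmetry; apply e |].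
apply span_plus; [apply span_plus; apply span_scal, (span_exp (lowexp M)) |].
- exists 0%Z; lia.
- exists 0%Z; lia.
- eapply span_mono; [| exact hg]; apply lowexp_le.
Qed.

(** The cosine sends e^{i(M+1)x} to half of e^{i(M+2)x} plus half of e^{iMx}; the second half joins
    the lower terms. *)
Lemma lead_step (M : Z) (f g : R -> C) (p q : C) (a b : R) :
  (0 <= M)%Z -> lead (M + 1) f p q -> span (lowexp M) g ->
  lead (M + 2) (fun x => (RtoC a * (RtoC (cos x) * f x) - RtoC b * g x)%C)
    (RtoC (a / 2) * p)%C (RtoC (a / 2) * q)%C.
Proof.
intros hM [f' [hf' e]] hg.
exists (fun x => (RtoC (a / 2) * p * cexpi (IZR M * x)
  + RtoC (a / 2) * q * cexpi (IZR (- M) * x)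
  + RtoC a * (RtoC (cos x) * f' x) - RtoC b * g x)%C); split.
- replace (M + 2 - 2)%Z with M by ring.
  apply span_minus; [| now apply span_scal].
  apply span_plus.
  + apply span_plus; apply span_scal, (span_exp (lowexp M)); exists 0%Z; lia.
  + apply span_scal; replace M with (M + 1 - 2 + 1)%Z by ring.
    now apply span_cos.
- intros x; rewrite e.
  pose proof (cos_cexpi (M + 1) x) as h1.
  pose proof (cos_cexpi (- (M + 1)) x) as h2.
  replace (M + 1 + 1)%Z with (M + 2)%Z in h1 by ring.
  replace (M + 1 - 1)%Z with M in h1 by ring.
  replace (- (M + 1) + 1)%Z with (- M)%Z in h2 by ring.
  replace (- (M + 1) - 1)%Z with (- (M + 2))%Z in h2 by ring.
  revert h1 h2.
  generalize (cexpi (IZR (M + 1) * x)) (cexpi (IZR (- (M + 1)) * x))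
    (cexpi (IZR (M + 2) * x)) (cexpi (IZR (- (M + 2)) * x))
    (cexpi (IZR M * x)) (cexpi (IZR (- M) * x)).
  intros u v u' v' w w' h1 h2.
  transitivity (RtoC a * (p * (RtoC (cos x) * u) + q * (RtoC (cos x) * v)
                          + RtoC (cos x) * f' x) - RtoC b * g x)%C; [ring |].
  rewrite h1, h2.
  apply injective_projections; simpl; field.
Qed.

(** The sequence starts in degree 1, because in degree 0 the two leading exponents coincide; G is
    the degree 0 predecessor. The ratio of p to q persists, which separates the even family from the
    odd one. *)
Lemma lead_seq (F : nat -> R -> C) (G : R -> C) (a b : nat -> R) (a0 b0 : R)
    (p q : C) :
  lead 1 (F 0%nat) p q -> span (lowexp 0) G -> a0 <> 0 ->
  (forall x, F 1%nat x = (RtoC a0 * (RtoC (cos x) * F 0%nat x) - RtoC b0 * G x)%C) ->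
  (forall m, a m <> 0) ->
  (forall m x, F (S (S m)) x
     = (RtoC (a m) * (RtoC (cos x) * F (S m) x) - RtoC (b m) * F m x)%C) ->
  forall m, exists c : R, c <> 0 /\
    lead (Z.of_nat (S m)) (F m) (RtoC c * p)%C (RtoC c * q)%C.
Proof.
intros h0 hG ha0 h1 ha hr.
assert (hext : forall M f g p q, (forall x, f x = g x) ->
                lead M f p q -> lead M g p q).
{ intros M f g p' q' e [h [hh e']]; exists h; split; [easy |].
  intros x; now rewrite <- e. }
apply nat_ind2.
- exists 1; split; [lra |]; rewrite !Cmult_1_l; exact h0.
- exists (a0 / 2); split; [lra |].
  apply (hext 2%Z _ _ _ _ (fun x => eq_sym (h1 x))).
  now apply (lead_step 0).
- intros m [c0 [hc0 l0]] [c [hc l1]].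
  exists (a m / 2 * c); split.
  + apply Rmult_integral_contrapositive_currified; [specialize (ha m); lra | easy].
  + apply (hext _ _ _ _ _ (fun x => eq_sym (hr m x))).
    pose proof (lead_span (Z.of_nat (S m)) _ _ _ ltac:(lia) l0) as s0.
    replace (Z.of_nat (S (S m))) with (Z.of_nat (S m) + 1)%Z in l1 by lia.
    replace (Z.of_nat (S (S (S m)))) with (Z.of_nat (S m) + 2)%Z by lia.
    rewrite RtoC_mult, <- !Cmult_assoc.
    now apply lead_step.
Qed.

Lemma lead_geg (l : R) (m : nat) :
  0 < l -> exists c : R, c <> 0 /\
  lead (Z.of_nat (S m)) (fun x => RtoC (geg l (S m) (cos x))) (RtoC c) (RtoC c).
Proof.
intros hl.
destruct (lead_seq (fun m x => RtoC (geg l (S m) (cos x))) (fun _ => RtoC 1)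
  (fun m => 2 * (INR (S m) + 1 + l) / (INR (S m) + 2))
  (fun m => (INR (S m) + 2 * l) / (INR (S m) + 2))
  (2 * (INR 0 + 1 + l) / (INR 0 + 2)) ((INR 0 + 2 * l) / (INR 0 + 2))
  (RtoC l) (RtoC l)) with (m := m) as [c [hc h]].
- exists (fun _ => RtoC 0); split; [apply span_zero |].
  intros x; rewrite geg_1; unfold cexpi; simpl.
  replace (1 * x) with x by ring; replace (-1 * x) with (- x) by ring.
  rewrite cos_neg, sin_neg; apply injective_projections; simpl; ring.
- apply (span_ext _ (expz 0%Z)).
  + intros x; unfold cexpi; rewrite Rmult_0_l, cos_0, sin_0; easy.
  + apply span_exp; exists 0%Z; lia.
- simpl; apply Rgt_not_eq, Rdiv_lt_0_compat; lra.
- intros x; rewrite geg_SS, geg_0.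
  apply injective_projections; simpl; ring.
- intros j; pose proof (pos_INR (S j)).
  apply Rgt_not_eq, Rdiv_lt_0_compat; lra.
- intros j x; rewrite (geg_SS l (cos x) (S j)).
  generalize (INR (S j)); intros n.
  apply injective_projections; simpl; ring.
- exists (c * l); split; [apply Rmult_integral_contrapositive_currified; lra |].
  now rewrite RtoC_mult.
Qed.

Lemma lead_sin_geg (l : R) (m : nat) :
  0 < l -> exists c : R, c <> 0 /\
  lead (Z.of_nat (S m)) (fun x => RtoC (sin x * geg l m (cos x)))
    (RtoC c * - Ci)%C (RtoC c * Ci)%C.
Proof.
intros hl.
destruct (lead_seq (fun m x => RtoC (sin x * geg l m (cos x))) (fun _ => RtoC 0)
  (fun m => 2 * (INR m + 1 + l) / (INR m + 2))
  (fun m => (INR m + 2 * l) / (INR m + 2))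
  (2 * l) 0 (RtoC (/ 2) * - Ci)%C (RtoC (/ 2) * Ci)%C) with (m := m)
  as [c [hc h]].
- exists (fun _ => RtoC 0); split; [apply span_zero |].
  intros x; rewrite geg_0; unfold cexpi; simpl.
  replace (1 * x) with x by ring; replace (-1 * x) with (- x) by ring.
  rewrite cos_neg, sin_neg; apply injective_projections; simpl; field.
- apply span_zero.
- lra.
- intros x; rewrite geg_1, geg_0; apply injective_projections; simpl; ring.
- intros j; pose proof (pos_INR j).
  apply Rgt_not_eq, Rdiv_lt_0_compat; lra.
- intros j x; rewrite (geg_SS l (cos x) j).
  apply injective_projections; simpl; ring.
- exists (c * / 2); split; [apply Rmult_integral_contrapositive_currified; lra |].
  now rewrite RtoC_mult, <- !Cmult_assoc.
Qed.

(** * The weighted inner product *)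

Definition ccont (f : R -> C) : Prop :=
  cont (fun x => fst (f x)) /\ cont (fun x => snd (f x)).

Lemma ccont_expz (j : Z) : ccont (expz j).
Proof. split; simpl; solve_cont. Qed.

Lemma ccont_plus (f g : R -> C) :
  ccont f -> ccont g -> ccont (fun x => (f x + g x)%C).
Proof. intros [f1 f2] [g1 g2]; split; simpl; now apply cont_plus. Qed.

Lemma ccont_mult (f g : R -> C) :
  ccont f -> ccont g -> ccont (fun x => (f x * g x)%C).
Proof.
intros [f1 f2] [g1 g2]; split; simpl;
  [apply cont_minus | apply cont_plus]; now apply cont_mult.
Qed.

Lemma ccont_const (c : C) : ccont (fun _ => c).
Proof. split; apply cont_const. Qed.

Lemma ccont_conj (f : R -> C) : ccont f -> ccont (fun x => Cconj (f x)).
Proof. intros [f1 f2]; split; simpl; [easy | now apply cont_opp]. Qed.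

Lemma ccont_RtoC (f : R -> R) : cont f -> ccont (fun x => RtoC (f x)).
Proof. intros hf; split; simpl; [easy | apply cont_const]. Qed.

Lemma ccont_ext (f g : R -> C) : (forall x, f x = g x) -> ccont f -> ccont g.
Proof.
intros e [f1 f2]; split; intros x;
  [eapply continuous_ext; [| apply f1] | eapply continuous_ext; [| apply f2]];
  intros y; simpl; now rewrite e.
Qed.

Lemma span_ccont (P : Z -> Prop) (f : R -> C) : span P f -> ccont f.
Proof.
induction 1.
- apply ccont_expz.
- apply ccont_const.
- now apply ccont_plus.
- now apply ccont_mult; [apply ccont_const |].
- eapply ccont_ext; eassumption.
Qed.

Definition cLam (l : R) (f : R -> C) : C :=
  (Lam l (fun x => fst (f x)), Lam l (fun x => snd (f x))).

Lemma Lam_ext_in (l : R) (f g : R -> R) :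
  (forall x, - PI <= x <= PI -> f x = g x) -> Lam l f = Lam l g.
Proof.
intros h; apply RInt_ext; intros x.
pose proof PI_RGT_0; rewrite Rmin_left, Rmax_right by lra.
intros hx; rewrite h by lra; easy.
Qed.

Lemma cLam_ext (l : R) (f g : R -> C) :
  (forall x, - PI <= x <= PI -> f x = g x) -> cLam l f = cLam l g.
Proof.
intros h; unfold cLam; f_equal; apply Lam_ext_in; intros x hx; now rewrite h.
Qed.

Lemma cLam_plus (l : R) (f g : R -> C) :
  0 < l -> ccont f -> ccont g ->
  cLam l (fun x => (f x + g x)%C) = (cLam l f + cLam l g)%C.
Proof.
intros hl [f1 f2] [g1 g2].
apply injective_projections; simpl; now apply Lam_plus.
Qed.

Lemma cLam_scal (l : R) (c : C) (f : R -> C) :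
  0 < l -> ccont f -> cLam l (fun x => (c * f x)%C) = (c * cLam l f)%C.
Proof.
intros hl [f1 f2].
apply injective_projections; simpl.
- rewrite (Lam_ext _ _ (fun x => fst c * fst (f x) + - snd c * snd (f x)))
    by (intros; ring).
  rewrite Lam_plus, !Lam_scal by (easy || solve_cont); ring.
- rewrite Lam_plus, !Lam_scal by (easy || solve_cont); ring.
Qed.

Definition ip (l : R) (f g : R -> C) : C := cLam l (fun x => (f x * Cconj (g x))%C).

Lemma ip_ext (l : R) (f f' g g' : R -> C) :
  (forall x, - PI <= x <= PI -> f x = f' x) ->
  (forall x, - PI <= x <= PI -> g x = g' x) -> ip l f g = ip l f' g'.
Proof.
intros e e'; apply cLam_ext; intros x hx; now rewrite e, e'.
Qed.

Lemma ip_plus_l (l : R) (f f' g : R -> C) :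
  0 < l -> ccont f -> ccont f' -> ccont g ->
  ip l (fun x => (f x + f' x)%C) g = (ip l f g + ip l f' g)%C.
Proof.
intros hl hf hf' hg; unfold ip.
rewrite <- cLam_plus by (easy || (apply ccont_mult; [easy | now apply ccont_conj])).
apply cLam_ext; intros; ring.
Qed.

Lemma ip_scal_l (l : R) (c : C) (f g : R -> C) :
  0 < l -> ccont f -> ccont g ->
  ip l (fun x => (c * f x)%C) g = (c * ip l f g)%C.
Proof.
intros hl hf hg; unfold ip.
rewrite <- cLam_scal by (easy || (apply ccont_mult; [easy | now apply ccont_conj])).
apply cLam_ext; intros; ring.
Qed.

Lemma ip_plus_r (l : R) (f g g' : R -> C) :
  0 < l -> ccont f -> ccont g -> ccont g' ->
  ip l f (fun x => (g x + g' x)%C) = (ip l f g + ip l f g')%C.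
Proof.
intros hl hf hg hg'; unfold ip.
rewrite <- cLam_plus by (easy || (apply ccont_mult; [easy | now apply ccont_conj])).
apply cLam_ext; intros; rewrite Cplus_conj; ring.
Qed.

Lemma ip_scal_r (l : R) (c : C) (f g : R -> C) :
  0 < l -> ccont f -> ccont g ->
  ip l f (fun x => (c * g x)%C) = (Cconj c * ip l f g)%C.
Proof.
intros hl hf hg; unfold ip.
rewrite <- cLam_scal by (easy || (apply ccont_mult; [easy | now apply ccont_conj])).
apply cLam_ext; intros; rewrite Cmult_conj; ring.
Qed.

Lemma ip_span_0 (l : R) (P : Z -> Prop) (f g : R -> C) :
  0 < l -> ccont f -> (forall j, P j -> ip l f (expz j) = RtoC 0) ->
  span P g -> ip l f g = RtoC 0.
Proof.
intros hl hf h0 hg.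
induction hg as [j hj | | g g' hg IH hg' IH' | c g hg IH | g g' e hg IH].
- now apply h0.
- transitivity (ip l f (fun x => (RtoC 0 * RtoC 0)%C)).
  + apply ip_ext; intros; ring.
  + rewrite (ip_scal_r l (RtoC 0) f (fun _ => RtoC 0));
      [| easy | easy | apply ccont_const].
    apply injective_projections; simpl; ring.
- rewrite ip_plus_r, IH, IH'; [ring | easy | easy | |];
    eapply span_ccont; eassumption.
- rewrite ip_scal_r, IH; [ring | easy | easy |].
  eapply span_ccont; eassumption.
- rewrite <- IH; apply ip_ext; [easy | intros; symmetry; apply e].
Qed.

(** Such an f is orthogonal to itself, so |f|^2 has integral 0 and, being continuous, vanishes. *)
Lemma span_orth_0 (l : R) (P : Z -> Prop) (f : R -> C) :
  0 < l -> span P f -> (forall j, P j -> ip l f (expz j) = RtoC 0) ->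
  forall x, - PI <= x <= PI -> f x = RtoC 0.
Proof.
intros hl hf h0 x hx.
pose proof (span_ccont P f hf) as [f1 f2].
pose proof (ip_span_0 l P f f hl (conj f1 f2) h0 hf) as h.
apply (f_equal fst) in h; simpl in h.
set (q := fun y => fst (f y) * fst (f y) + snd (f y) * snd (f y)).
rewrite (Lam_ext _ _ q) in h by (intros; unfold q; ring).
assert (hq : ~ 0 < q x).
{ intros hp; pose proof (Lam_pos_of_point l q x hl) as h'.
  rewrite h in h'.
  apply (Rlt_irrefl 0), h'; [unfold q; solve_cont | | easy | easy].
  intros y; unfold q; nra. }
unfold q in hq; apply injective_projections; simpl; nra.
Qed.

(** C_j^1 is the Chebyshev polynomial of the second kind. *)
Lemma sin_succ_mul (j : nat) (x : R) :
  sin (INR (S j) * x) = sin x * geg 1 j (cos x).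
Proof.
revert j; apply (nat_ind2 (fun j => sin (INR (S j) * x) = sin x * geg 1 j (cos x))).
- rewrite geg_0; simpl; rewrite Rmult_1_l; ring.
- rewrite geg_1; simpl; replace ((1 + 1) * x) with (2 * x) by ring.
  rewrite sin_2a; ring.
- intros j IH0 IH1.
  pose proof (pos_INR j).
  rewrite (S_INR (S (S j))), (S_INR (S j)) in *; rewrite (S_INR j) in *.
  rewrite geg_SS.
  replace (2 * (INR j + 1 + 1) / (INR j + 2)) with 2 by (field; lra).
  replace ((INR j + 2 * 1) / (INR j + 2)) with 1 by (field; lra).
  replace ((INR j + 1 + 1 + 1) * x) with ((INR j + 1 + 1) * x + x) by ring.
  replace ((INR j + 1) * x) with ((INR j + 1 + 1) * x - x) in IH0 by ring.
  rewrite sin_minus in IH0; rewrite sin_plus.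
  set (s := sin ((INR j + 1 + 1) * x)) in *.
  transitivity (2 * cos x * s - (s * cos x - cos ((INR j + 1 + 1) * x) * sin x));
    [ring |].
  rewrite IH0, IH1; ring.
Qed.

Lemma cos_IZR (j : Z) (x : R) : cos (IZR j * x) = cos (INR (Z.abs_nat j) * x).
Proof.
rewrite INR_IZR_INZ, Zabs2Nat.id_abs.
destruct (Z.abs_eq_or_opp j) as [-> | ->]; [easy |].
rewrite opp_IZR, <- cos_neg; f_equal; ring.
Qed.

Lemma sin_IZR (j : Z) :
  exists s, forall x, sin (IZR j * x) = s * sin (INR (Z.abs_nat j) * x).
Proof.
destruct (Z.abs_eq_or_opp j) as [e | e]; [exists 1 | exists (-1)]; intros x;
  rewrite INR_IZR_INZ, Zabs2Nat.id_abs, e.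
- ring.
- rewrite opp_IZR; replace (- IZR j * x) with (- (IZR j * x)) by ring.
  rewrite sin_neg; ring.
Qed.

Lemma ip_real_expz (l : R) (f : R -> R) (j : Z) :
  0 < l -> cont f ->
  Lam l (fun x => f x * cos (IZR j * x)) = 0 ->
  Lam l (fun x => f x * sin (IZR j * x)) = 0 ->
  ip l (fun x => RtoC (f x)) (expz j) = RtoC 0.
Proof.
intros hl hf hc hs; apply injective_projections; simpl.
- etransitivity; [| exact hc]; apply Lam_ext; intros; ring.
- rewrite (Lam_ext _ _ (fun x => -1 * (f x * sin (IZR j * x))))
    by (intros; ring).
  rewrite Lam_scal, hs by (easy || solve_cont); ring.
Qed.

Lemma geg_orth_expz (l : R) (m : nat) (j : Z) :
  0 < l -> (Z.abs j < Z.of_nat m)%Z ->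
  ip l (fun x => RtoC (geg l m (cos x))) (expz j) = RtoC 0.
Proof.
intros hl hj; apply ip_real_expz; [easy | solve_cont | |].
- rewrite (Lam_ext _ _ (fun x =>
    geg l m (cos x) * cos (INR (Z.abs_nat j) * x)))
    by (intros; now rewrite cos_IZR).
  apply (Lam_geg_orth l (fun i x => cos (INR i * x)) (fun _ => 2) (fun _ => 1) 1);
    [easy | | | | | lia].
  + intros i; solve_cont.
  + intros x; simpl; now rewrite Rmult_0_l, cos_0.
  + intros x; simpl; now rewrite !Rmult_1_l.
  + intros i x; rewrite !S_INR.
    replace ((INR i + 1 + 1) * x) with ((INR i + 1) * x + x) by ring.
    replace (INR i * x) with ((INR i + 1) * x - x) by ring.
    rewrite cos_plus, cos_minus; ring.
- apply Lam_odd; [easy | solve_cont |].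
  intros x; replace (IZR j * - x) with (- (IZR j * x)) by ring.
  rewrite cos_neg, sin_neg; ring.
Qed.

Lemma wk_succ (l x : R) : wk (l + 1) x = sin x * sin x * wk l x.
Proof.
unfold wk; replace (2 * (l + 1)) with (2 * l + 1 + 1) by ring.
rewrite !rpow_succ by apply Rabs_pos.
rewrite <- (Rabs_pos_eq (sin x * sin x)), Rabs_mult by nra; ring.
Qed.

Lemma Lam_sin_sq (l : R) (f : R -> R) :
  Lam l (fun x => sin x * sin x * f x) = Lam (l + 1) f.
Proof. apply RInt_ext; intros x _; rewrite wk_succ; to_R; ring. Qed.

(** The sine of j x contributes a second factor sin x, and sin^2 x raises the weight to parameter l
    + 1, where C_m^{l+1} is orthogonal to lower degrees. *)
Lemma sin_geg_orth_expz (l : R) (m : nat) (j : Z) :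
  0 < l -> (Z.abs j < Z.of_nat (S m))%Z ->
  ip l (fun x => RtoC (sin x * geg (l + 1) m (cos x))) (expz j) = RtoC 0.
Proof.
intros hl hj; apply ip_real_expz; [easy | solve_cont | |].
- apply Lam_odd; [easy | solve_cont |].
  intros x; replace (IZR j * - x) with (- (IZR j * x)) by ring.
  rewrite !cos_neg, sin_neg; ring.
- destruct (sin_IZR j) as [s hs].
  rewrite (Lam_ext _ _ (fun x => s * (sin x * geg (l + 1) m (cos x)
    * sin (INR (Z.abs_nat j) * x)))) by (intros; rewrite hs; ring).
  rewrite Lam_scal by (easy || solve_cont).
  destruct (Z.abs_nat j) as [|i] eqn:hi.
  + rewrite (Lam_ext _ _ (fun x => 0 * 1)).
    * rewrite (Lam_scal l 0 (fun _ => 1)) by (easy || apply cont_const); ring.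
    * intros x; simpl; rewrite Rmult_0_l, sin_0; ring.
  + rewrite (Lam_ext _ _ (fun x => sin x * sin x
      * (geg (l + 1) m (cos x) * geg 1 i (cos x))))
      by (intros; rewrite sin_succ_mul; ring).
    rewrite Lam_sin_sq.
    rewrite (Lam_geg_orth (l + 1) (fun i x => geg 1 i (cos x))
      (fun j => 2 * (INR j + 1 + 1) / (INR j + 2))
      (fun j => (INR j + 2 * 1) / (INR j + 2)) (2 * 1));
      [ring | lra | | easy | easy | | lia].
    * intros p; solve_cont.
    * intros p x; now rewrite geg_SS.
Qed.

(** * The non-symmetric Heckman-Opdam polynomials *)

Lemma tri_lowexp (n j : Z) :
  lowexp (Z.abs n - 2) j -> tri j n = true.
Proof.
intros [i [h0 hi]]; unfold tri.
replace (Z.abs j <? Z.abs n)%Z with true by (symmetry; apply Z.ltb_lt; lia).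
replace (Z.abs n - Z.abs j)%Z with (2 * (i + 1))%Z by lia.
rewrite Z.even_mul; easy.
Qed.

Lemma span_sum (P : Z -> Prop) (F : nat -> R -> C) (a n : nat) :
  (forall i, (a <= i < a + n)%nat -> span P (F i)) ->
  exists f, span P f /\
    forall x, sum_n_m (fun i => F i x) a (a + n) = (f x + F (a + n)%nat x)%C.
Proof.
induction n as [|n IH]; intros h.
- exists (fun _ => RtoC 0); split; [apply span_zero |].
  intros x; rewrite Nat.add_0_r, sum_n_n; symmetry; apply Cplus_0_l.
- destruct IH as [f [hf e]]; [intros i hi; apply h; lia |].
  exists (fun x => (f x + F (a + n)%nat x)%C); split.
  + apply span_plus; [easy | apply h; lia].
  + intros x; rewrite Nat.add_succ_r, sum_n_Sm, e by lia; easy.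
Qed.

(** For |n| >= 1 the first and last terms of the sum are distinct and carry the exponents -|n| and
    |n|. In between, [tri] keeps only the parity of n and [Ecoef] is 0 elsewhere. *)
Lemma Efun_split (c : Z -> C) (n : Z) (m : nat) :
  Z.abs n = Z.of_nat (S m) ->
  exists f, span (lowexp (Z.abs n - 2)) f /\
    forall x, Efun c n x =
      (Ecoef c n (Z.abs n) * cexpi (IZR (Z.abs n) * x)
       + Ecoef c n (- Z.abs n) * cexpi (IZR (- Z.abs n) * x) + f x)%C.
Proof.
intros hn.
set (F := fun (i : nat) (x : R) => let j := (Z.of_nat i - Z.abs n)%Z in
  (Ecoef c n j * cexpi (IZR j * x))%C).
destruct (span_sum (lowexp (Z.abs n - 2)) F 1 (2 * m + 1)) as [f [hf e]].
{ intros i hi; unfold F; cbv zeta; set (j := (Z.of_nat i - Z.abs n)%Z).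
  unfold Ecoef; destruct (Z.eq_dec j n) as [e | _]; [lia |].
  destruct (tri j n) eqn:ht.
  - apply span_scal, (span_exp (lowexp (Z.abs n - 2))).
    unfold tri in ht; apply Bool.orb_prop in ht.
    destruct ht as [ht | ht]; apply andb_prop in ht; destruct ht as [h1 h2].
    + apply Z.ltb_lt in h1; apply Z.even_spec in h2; destruct h2 as [i' h2].
      exists (i' - 1)%Z; lia.
    + apply Z.eqb_eq in h1; lia.
  - apply (span_ext _ (fun _ => RtoC 0)); [intros; ring | apply span_zero]. }
exists f; split; [easy |].
intros x; unfold Efun.
change (sum_n_m (fun i => F i x) 0 (2 * Z.abs_nat n)
  = (Ecoef c n (Z.abs n) * cexpi (IZR (Z.abs n) * x)
     + Ecoef c n (- Z.abs n) * cexpi (IZR (- Z.abs n) * x) + f x)%C).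
rewrite sum_Sn_m by lia.
replace (2 * Z.abs_nat n)%nat with (1 + (2 * m + 1))%nat by lia.
rewrite e; change (F 0%nat x + (f x + F (1 + (2 * m + 1))%nat x)
  = Ecoef c n (Z.abs n) * cexpi (IZR (Z.abs n) * x)
     + Ecoef c n (- Z.abs n) * cexpi (IZR (- Z.abs n) * x) + f x)%C.
unfold F; cbv zeta.
replace (Z.of_nat 0 - Z.abs n)%Z with (- Z.abs n)%Z by lia.
replace (Z.of_nat (1 + (2 * m + 1)) - Z.abs n)%Z with (Z.abs n) by lia.
ring.
Qed.

Lemma cLam_scal_RtoC (l : R) (c : C) (f : R -> R) :
  0 < l -> cont f ->
  cLam l (fun x => (c * RtoC (f x))%C) = (c * RtoC (Lam l f))%C.
Proof.
intros hl hf; rewrite (cLam_scal l c (fun x => RtoC (f x)));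
  [| easy | now apply ccont_RtoC].
f_equal; apply injective_projections; simpl; [easy |].
rewrite (Lam_ext _ _ (fun x => 0 * f x)) by (intros; ring).
rewrite Lam_scal by easy; ring.
Qed.

Lemma cLam_comb (l : R) (p q s : C) (f g h : R -> R) :
  0 < l -> cont f -> cont g -> cont h ->
  cLam l (fun x => (p * RtoC (f x) + (q * RtoC (g x) + s * RtoC (h x)))%C)
  = (p * RtoC (Lam l f) + (q * RtoC (Lam l g) + s * RtoC (Lam l h)))%C.
Proof.
intros hl hf hg hh.
assert (hc : forall c f, cont f -> ccont (fun x => (c * RtoC (f x))%C)).
{ intros c f' hf'; apply ccont_mult; [apply ccont_const | now apply ccont_RtoC]. }
rewrite <- !cLam_scal_RtoC by easy.
rewrite (cLam_plus l (fun x => (p * RtoC (f x))%C)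
           (fun x => (q * RtoC (g x) + s * RtoC (h x))%C));
  [| easy | now apply hc | now apply ccont_plus; apply hc].
f_equal; apply (cLam_plus l (fun x => (q * RtoC (g x))%C)
                  (fun x => (s * RtoC (h x))%C)); auto.
Qed.

Lemma ccont_Efun (c : Z -> C) (n : Z) : ccont (Efun c n).
Proof.
set (F := fun (i : nat) (x : R) => let j := (Z.of_nat i - Z.abs n)%Z in
  (Ecoef c n j * cexpi (IZR j * x))%C).
assert (hF : forall i, ccont (F i)).
{ intros i; apply ccont_mult; [apply ccont_const | apply ccont_expz]. }
change (ccont (fun x => sum_n_m (fun i => F i x) 0 (2 * Z.abs_nat n))).
generalize (2 * Z.abs_nat n)%nat; intros N.
induction N as [|N IH].
- apply (ccont_ext (F 0%nat)); [| apply hF].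
  intros x; symmetry; apply (sum_n_n (fun i => F i x)).
- eapply ccont_ext; [| exact (ccont_plus _ _ IH (hF (S N)))].
  intros x; symmetry; apply (sum_n_Sm (fun i => F i x) 0 N); lia.
Qed.

(** Continuity makes the complex-valued integral of the definition the pair of integrals of its
    components. *)
Lemma IsHO_ip (k : R) (n j : Z) (c : Z -> C) :
  0 < k -> IsHO k n c -> tri j n = true -> ip k (Efun c n) (expz j) = RtoC 0.
Proof.
intros hk h hj; rewrite <- (h j hj); symmetry.
pose proof (cont_wk k hk) as hw.
destruct (ccont_mult _ _ (ccont_Efun c n) (ccont_conj _ (ccont_expz j)))
  as [c1 c2].
apply (is_RInt_unique (V := C_R_CompleteNormedModule)).
apply (is_RInt_fct_extend_pair (U := R_NormedModule) (V := R_NormedModule)).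
- apply (is_RInt_ext (V := R_NormedModule)
    (fun x => fst (Efun c n x * Cconj (cexpi (IZR j * x)))%C * wk k x)).
  + intros x _; apply Rmult_comm.
  + apply (RInt_correct (V := R_CompleteNormedModule)), ex_RInt_cont.
    now apply cont_mult.
- apply (is_RInt_ext (V := R_NormedModule)
    (fun x => snd (Efun c n x * Cconj (cexpi (IZR j * x)))%C * wk k x)).
  + intros x _; apply Rmult_comm.
  + apply (RInt_correct (V := R_CompleteNormedModule)), ex_RInt_cont.
    now apply cont_mult.
Qed.

Lemma normsq_Lam (k : R) (c : Z -> C) (n : Z) (f : R -> R) :
  (forall x, - PI <= x <= PI -> Cmod (Efun c n x) ^ 2 = f x) ->
  normsq k c n = Lam k f.
Proof. intros h; unfold normsq; now apply (Lam_ext_in k). Qed.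

Lemma Cmod_sq (z : C) : Cmod z ^ 2 = fst z * fst z + snd z * snd z.
Proof.
unfold Cmod; rewrite pow2_sqrt; [ring |]; nra.
Qed.

(* Real functions [A] (even) and [B] (odd), normalised so that
   [(A + iB) / 2 = e^{iMx} + lower] and [(A - iB) / 2 = e^{-iMx} + lower]. *)
Section Pair.

Variables (k : R) (M : Z) (m : nat) (A B : R -> R) (E : Z -> Z -> C).
Hypotheses (hk : 0 < k) (hM : M = Z.of_nat (S m)).
Hypotheses (cA : cont A) (cB : cont B).
Hypotheses (eA : forall x, A (- x) = A x) (oB : forall x, B (- x) = - B x).
Hypotheses (leadA : lead M (fun x => RtoC (A x)) (RtoC 1) (RtoC 1)).
Hypotheses (leadB : lead M (fun x => RtoC (B x)) (- Ci)%C Ci).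
Hypotheses
  (orthA : forall j, lowexp (M - 2) j ->
     ip k (fun x => RtoC (A x)) (expz j) = RtoC 0)
  (orthB : forall j, lowexp (M - 2) j ->
     ip k (fun x => RtoC (B x)) (expz j) = RtoC 0).
Hypotheses (hE : forall n, IsHO k n (E n)).

Let U (x : R) : C := (RtoC (/ 2) * RtoC (A x) + RtoC (/ 2) * Ci * RtoC (B x))%C.
Let V (x : R) : C := (RtoC (/ 2) * RtoC (A x) + RtoC (/ 2) * - Ci * RtoC (B x))%C.
Let a := Lam k (fun x => A x * A x).
Let b := Lam k (fun x => B x * B x).

Lemma pair_ccont (p q : C) :
  ccont (fun x => (p * RtoC (A x) + q * RtoC (B x))%C).
Proof.
apply ccont_plus; (apply ccont_mult; [apply ccont_const | now apply ccont_RtoC]).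
Qed.

Lemma pair_orth (p q : C) (j : Z) :
  lowexp (M - 2) j ->
  ip k (fun x => (p * RtoC (A x) + q * RtoC (B x))%C) (expz j) = RtoC 0.
Proof.
intros hj.
rewrite ip_plus_l, !ip_scal_l, orthA, orthB;
  try easy; try apply ccont_expz; try (now apply ccont_RtoC);
  try (apply ccont_mult; [apply ccont_const | now apply ccont_RtoC]).
ring.
Qed.

Lemma U_split : exists g, span (lowexp (M - 2)) g /\
  forall x, U x = (cexpi (IZR M * x) + g x)%C.
Proof.
destruct leadA as [f [hf ef]]; destruct leadB as [g [hg eg]].
exists (fun x => (RtoC (/ 2) * f x + RtoC (/ 2) * Ci * g x)%C); split.
- apply span_plus; now apply span_scal.
- intros x; unfold U; rewrite ef, eg.
  apply injective_projections; simpl; field.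
Qed.

Lemma V_split : exists g, span (lowexp (M - 2)) g /\
  forall x, V x = (cexpi (IZR (- M) * x) + g x)%C.
Proof.
destruct leadA as [f [hf ef]]; destruct leadB as [g [hg eg]].
exists (fun x => (RtoC (/ 2) * f x + RtoC (/ 2) * - Ci * g x)%C); split.
- apply span_plus; now apply span_scal.
- intros x; unfold V; rewrite ef, eg.
  apply injective_projections; simpl; field.
Qed.

Lemma E_orth (n j : Z) :
  Z.abs n = M -> lowexp (M - 2) j -> ip k (Efun (E n) n) (expz j) = RtoC 0.
Proof.
intros hn hj; apply IsHO_ip; [easy | apply hE |].
apply tri_lowexp; now rewrite hn.
Qed.

(** E_n, A and B are all orthogonal to the lower exponentials, hence so is g, which lies in their
    span. *)
Lemma E_pair_unique (n : Z) (p q : C) (g : R -> C) :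
  Z.abs n = M -> span (lowexp (M - 2)) g ->
  (forall x, Efun (E n) n x = (p * RtoC (A x) + q * RtoC (B x) + g x)%C) ->
  forall x, - PI <= x <= PI ->
  Efun (E n) n x = (p * RtoC (A x) + q * RtoC (B x))%C.
Proof.
intros hn hg e x hx.
enough (h : g x = RtoC 0) by (rewrite e, h; ring).
apply (span_orth_0 k _ g hk hg); [| easy].
intros j hj.
pose proof (E_orth n j hn hj) as h.
rewrite (ip_ext k _ (fun x => ((p * RtoC (A x) + q * RtoC (B x)) + g x)%C)
           _ (expz j)) in h by (intros; easy || apply e).
rewrite ip_plus_l, pair_orth in h;
  [| easy | easy | apply pair_ccont | now apply (span_ccont (lowexp (M - 2)))
   | apply ccont_expz].
rewrite <- h; ring.
Qed.

(** In the order, -M is not below M, so E_M has no term in e^{-iMx} and its leading part is that of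
    U. *)
Lemma E_pos (x : R) : - PI <= x <= PI -> Efun (E M) M x = U x.
Proof.
assert (hn : Z.abs M = M) by lia.
destruct (Efun_split (E M) M m ltac:(lia)) as [f [hf ef]].
destruct U_split as [g [hg eg]].
rewrite hn in *.
apply (E_pair_unique M _ _ (fun x => (f x - g x)%C) hn).
- now apply span_minus.
- intros y; change (Efun (E M) M y = (U y + (f y - g y))%C).
  rewrite ef, eg.
  assert (e1 : Ecoef (E M) M M = RtoC 1)
    by (unfold Ecoef; destruct (Z.eq_dec M M); [easy | lia]).
  assert (e2 : Ecoef (E M) M (- M) = RtoC 0).
  { unfold Ecoef; destruct (Z.eq_dec (- M) M); [lia |].
    replace (tri (- M) M) with false; [easy |].
    unfold tri; symmetry; apply Bool.orb_false_intro; apply Bool.andb_false_iff.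
    - left; apply Z.ltb_ge; lia.
    - right; apply Z.ltb_ge; lia. }
  rewrite e1, e2; ring.
Qed.

(** M is below -M, so E_{-M} may contain e^{iMx}; with c its coefficient, E_{-M} = V + c U. *)
Lemma E_neg_aux :
  exists c : C, forall x, - PI <= x <= PI -> Efun (E (- M)) (- M) x
    = (RtoC (/ 2) * (1 + c) * RtoC (A x)
       + RtoC (/ 2) * (c - 1) * Ci * RtoC (B x))%C.
Proof.
exists (E (- M)%Z M).
assert (hn : Z.abs (- M) = M) by lia.
destruct (Efun_split (E (- M)%Z) (- M) m ltac:(lia)) as [f [hf ef]].
destruct U_split as [g [hg eg]]; destruct V_split as [h [hh eh]].
rewrite hn in *; set (c := E (- M)%Z M) in *.
apply (E_pair_unique (- M) _ _ (fun x => (f x - h x - c * g x)%C) hn).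
- apply span_minus; [now apply span_minus | now apply span_scal].
- intros y.
  transitivity ((V y + c * U y) + (f y - h y - c * g y))%C;
    [| unfold U, V; ring].
  rewrite ef, eg, eh.
  assert (e1 : Ecoef (E (- M)%Z) (- M) (- M) = RtoC 1)
    by (unfold Ecoef; destruct (Z.eq_dec (- M) (- M)); [easy | lia]).
  assert (e2 : Ecoef (E (- M)%Z) (- M) M = c).
  { unfold Ecoef; destruct (Z.eq_dec M (- M)); [lia |].
    replace (tri M (- M)) with true; [easy |].
    unfold tri; symmetry; apply Bool.orb_true_intro; right.
    apply andb_true_intro; split; [apply Z.eqb_eq | apply Z.ltb_lt]; lia. }
  rewrite e1, e2; ring.
Qed.

Lemma Lam_AB : Lam k (fun x => A x * B x) = 0.
Proof.
apply Lam_odd; [easy | solve_cont |]; intros x; rewrite eA, oB; ring.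
Qed.

Hypotheses (ha : 0 < a) (hb : 0 < b).

Lemma E_neg (x : R) :
  - PI <= x <= PI -> Efun (E (- M)) (- M) x
    = (RtoC (b / (a + b)) * RtoC (A x) + RtoC (a / (a + b)) * - Ci * RtoC (B x))%C.
Proof.
destruct E_neg_aux as [c hc]; intros hx.
destruct U_split as [g [hg eg]].
(* U differs from e^{iMx} by lower terms, so orthogonality to U carries the one remaining
   condition. *)
assert (h0 : ip k (Efun (E (- M)%Z) (- M)) U = RtoC 0).
{ rewrite (ip_ext k _ (Efun (E (- M)%Z) (- M)) _
             (fun x => (cexpi (IZR M * x) + g x)%C)) by (intros; easy || apply eg).
  rewrite ip_plus_r; [| easy | apply ccont_Efun | apply ccont_expz
    | now apply (span_ccont (lowexp (M - 2)))].
  rewrite (IsHO_ip k (- M) M); [| easy | apply hE |].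
  - rewrite (ip_span_0 k (lowexp (M - 2))); [ring | easy | apply ccont_Efun | | easy].
    intros j hj; apply E_orth; [lia | easy].
  - unfold tri; apply Bool.orb_true_intro; right.
    apply andb_true_intro; split; [apply Z.eqb_eq | apply Z.ltb_lt]; lia. }
rewrite (ip_ext k _ (fun x => (RtoC (/ 2) * (1 + c) * RtoC (A x)
       + RtoC (/ 2) * (c - 1) * Ci * RtoC (B x))%C) _ U) in h0
  by (intros; easy || now apply hc).
unfold ip in h0.
rewrite (cLam_ext k _ (fun x =>
  (RtoC (/ 4) * (1 + c) * RtoC (A x * A x)
   + (RtoC (/ 4) * (c - 1) * RtoC (B x * B x)
      + RtoC (/ 2) * - Ci * RtoC (A x * B x)))%C)) in h0.
2: { intros y _; unfold U; apply injective_projections; simpl; field. }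
rewrite (cLam_comb k _ _ _ (fun x => A x * A x) (fun x => B x * B x)
           (fun x => A x * B x)) in h0 by (easy || now apply cont_mult).
rewrite Lam_AB in h0; fold a b in h0.
(* The cross term in A B vanishes by parity, leaving (1 + c) a + (c - 1) b = 0. *)
assert (hcv : c = RtoC ((b - a) / (a + b))).
{ destruct c as [c1 c3]; pose proof (f_equal fst h0) as h1.
  pose proof (f_equal snd h0) as h2; simpl in h1, h2.
  apply injective_projections; simpl.
  - apply (Rmult_eq_reg_l (a + b)); [| lra].
    transitivity (b - a); [nra | field; lra].
  - apply (Rmult_eq_reg_l (a + b)); [| lra]; nra. }
rewrite hc, hcv by easy.
apply injective_projections; simpl; field; lra.
Qed.

Lemma pair_normsq_pos : normsq k (E M) M = (a + b) / 4.
Proof.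
rewrite (normsq_Lam k _ _ (fun x => / 4 * (A x * A x) + / 4 * (B x * B x))).
- rewrite Lam_plus, !Lam_scal by (easy || solve_cont); fold a b; field.
- intros x hx; rewrite E_pos, Cmod_sq by easy; unfold U; simpl; field.
Qed.

Lemma pair_normsq_neg : normsq k (E (- M)%Z) (- M) = a * b / (a + b).
Proof.
rewrite (normsq_Lam k _ _ (fun x => (b / (a + b)) ^ 2 * (A x * A x)
                                    + (a / (a + b)) ^ 2 * (B x * B x))).
- rewrite Lam_plus, !Lam_scal by (easy || solve_cont); fold a b; field; lra.
- intros x hx; rewrite E_neg, Cmod_sq by easy; simpl; field; lra.
Qed.

(** Both E_M, E_{-M} and A, B are orthogonal bases of the same plane, and a reproducing kernel does
    not depend on the basis. Replacing y by -y only changes the sign of B, which is complex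
    conjugation here. *)
Lemma pair_kernel (x y : R) :
  - PI <= x <= PI -> - PI <= y <= PI ->
  (RtoC (gam k (E M) M) * (Efun (E M) M x * Efun (E M) M (- y))
   + RtoC (gam k (E (- M)%Z) (- M))
     * (Efun (E (- M)%Z) (- M) x * Efun (E (- M)%Z) (- M) (- y)))%C
  = RtoC (A x * A y / a + B x * B y / b).
Proof.
intros hx hy; unfold gam; rewrite pair_normsq_pos, pair_normsq_neg.
rewrite !E_pos, !E_neg by lra; unfold U; rewrite eA, oB.
apply injective_projections; simpl; field; lra.
Qed.

End Pair.

Lemma lead_scal (M : Z) (f : R -> R) (c : R) (p q : C) :
  c <> 0 -> lead M (fun x => RtoC (f x)) (RtoC c * p)%C (RtoC c * q)%C ->
  lead M (fun x => RtoC (/ c * f x)) p q.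
Proof.
intros hc [g [hg e]].
exists (fun x => (RtoC (/ c) * g x)%C); split; [now apply span_scal |].
intros x; rewrite RtoC_mult, e.
transitivity ((RtoC (/ c) * RtoC c) * p * cexpi (IZR M * x)
  + (RtoC (/ c) * RtoC c) * q * cexpi (IZR (- M) * x) + RtoC (/ c) * g x)%C;
  [ring |].
rewrite <- RtoC_mult, Rinv_l by easy; ring.
Qed.

(** The leading constants p and q are only known to be nonzero; they cancel, since each summand is a
    product of two values divided by a squared norm. *)
Lemma E_kernel (k : R) (E : Z -> Z -> C) (m : nat) (x y : R) :
  0 < k -> (forall n, IsHO k n (E n)) ->
  - PI <= x <= PI -> - PI <= y <= PI ->
  let M := Z.of_nat (S m) in
  (RtoC (gam k (E M) M) * (Efun (E M) M x * Efun (E M) M (- y))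
   + RtoC (gam k (E (- M)%Z) (- M))
     * (Efun (E (- M)%Z) (- M) x * Efun (E (- M)%Z) (- M) (- y)))%C
  = RtoC (geg k (S m) (cos x) * geg k (S m) (cos y) / gnorm k (S m)
          + (sin x * sin y) * (geg (k + 1) m (cos x) * geg (k + 1) m (cos y))
            / gnorm (k + 1) m).
Proof.
intros hk hE hx hy M.
destruct (lead_geg k m hk) as [p [hp lA]].
destruct (lead_sin_geg (k + 1) m ltac:(lra)) as [q [hq lB]].
fold M in lA, lB.
pose proof (gnorm_pos k (S m) hk) as ha.
pose proof (gnorm_pos (k + 1) m ltac:(lra)) as hb.
set (A := fun x => / p * geg k (S m) (cos x)).
set (B := fun x => / q * (sin x * geg (k + 1) m (cos x))).
assert (hip : 0 < / p * / p)
  by (apply (Rsqr_pos_lt (/ p)), Rinv_neq_0_compat, hp).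
assert (hiq : 0 < / q * / q)
  by (apply (Rsqr_pos_lt (/ q)), Rinv_neq_0_compat, hq).
assert (na : Lam k (fun x => A x * A x) = / p * / p * gnorm k (S m)).
{ unfold gnorm; rewrite <- Lam_scal by (easy || (simpl; solve_cont)).
  apply Lam_ext; intros z; unfold A; ring. }
assert (nb : Lam k (fun x => B x * B x) = / q * / q * gnorm (k + 1) m).
{ unfold gnorm; rewrite <- Lam_sin_sq.
  rewrite <- Lam_scal by (easy || (simpl; solve_cont)).
  apply Lam_ext; intros z; unfold B; ring. }
rewrite (pair_kernel k M m A B E hk eq_refl).
- rewrite na, nb; f_equal; unfold A, B; field; repeat split; lra.
- unfold A; solve_cont.
- unfold B; solve_cont.
- intros z; unfold A; now rewrite cos_neg.
- intros z; unfold B; rewrite cos_neg, sin_neg; ring.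
- apply lead_scal; [easy |]; rewrite Cmult_1_r; exact lA.
- now apply lead_scal.
- intros j [i hi]; unfold A.
  rewrite (ip_ext k _ (fun x => (RtoC (/ p) * RtoC (geg k (S m) (cos x)))%C)
             _ (expz j)) by (intros; easy || apply RtoC_mult).
  rewrite (ip_scal_l k _ (fun x => RtoC (geg k (S m) (cos x)))), geg_orth_expz;
    [ring | easy | lia | easy | apply ccont_RtoC; solve_cont | apply ccont_expz].
- intros j [i hi]; unfold B.
  rewrite (ip_ext k _ (fun x =>
      (RtoC (/ q) * RtoC (sin x * geg (k + 1) m (cos x)))%C)
             _ (expz j)) by (intros; easy || apply RtoC_mult).
  rewrite (ip_scal_l k _ (fun x => RtoC (sin x * geg (k + 1) m (cos x)))),
    sin_geg_orth_expz;
    [ring | easy | lia | easy | apply ccont_RtoC; solve_cont | apply ccont_expz].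
- easy.
- rewrite na; now apply Rmult_lt_0_compat.
- rewrite nb; now apply Rmult_lt_0_compat.
- easy.
- easy.
Qed.

(** * The Poisson kernel *)

Definition arg_cos (x y u : R) : R := cos x * cos y + u * (sin x * sin y).

(** The first summand is the integral of C_n^k against 1, the second its integral against u, which
    is 0 for n = 0. *)
Definition kernel_J (k x y : R) (n : nat) : R :=
  kap k n * geg k n (cos x) * geg k n (cos y)
  + match n with
    | O => 0
    | S m => (sin x * sin y)
             * (kap (k + 1) m * geg (k + 1) m (cos x) * geg (k + 1) m (cos y))
    end.

Lemma sin_sq (x : R) : sin x * sin x = 1 - cos x * cos x.
Proof. pose proof (sin2_cos2 x) as h; unfold Rsqr in h; lra. Qed.

Lemma isJ_kernel (k x y : R) (n : nat) :
  0 < k ->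
  isJ k (fun u => (1 + u) * geg k n (arg_cos x y u)) (kernel_J k x y n).
Proof.
intros hk; unfold kernel_J.
pose proof (geg_product k (cos x) (cos y) _ _ n hk (sin_sq x) (sin_sq y)) as h1.
assert (h2 : isJ k (fun u => u * geg k n (arg_cos x y u))
  match n with
  | O => 0
  | S m => (sin x * sin y)
           * (kap (k + 1) m * geg (k + 1) m (cos x) * geg (k + 1) m (cos y))
  end).
{ destruct n as [|m].
  - eapply isJ_ext; [| exact (isJ_id k hk)]; intros u _; rewrite geg_0; ring.
  - apply isJ_geg_mul, geg_product; try apply sin_sq; lra. }
eapply isJ_ext; [| exact (isJ_plus _ _ _ _ _ h1 h2)].
intros u _; unfold arg_cos; ring.
Qed.

Lemma gnorm_inv (l : R) (m : nat) :
  0 < l -> / gnorm l m = (INR m + l) * kap l m / (2 * PI).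
Proof.
intros hl; rewrite <- (gnorm_kap l m hl).
pose proof (gnorm_pos l m hl); pose proof (pos_INR m).
assert (0 < kap l m)
  by (apply Rdiv_lt_0_compat; [now apply Bt_pos | now apply geg_at_1_pos]).
field; lra.
Qed.

Lemma Pterm_pair (k : R) (E : Z -> Z -> C) (r x y : R) (m : nat) :
  0 < k -> (forall n, IsHO k n (E n)) -> 0 <= r ->
  - PI <= x <= PI -> - PI <= y <= PI ->
  (Pterm k E r x y (Z.of_nat (S m)) + Pterm k E r x y (- Z.of_nat (S m)))%C
  = RtoC (rpow r k / (2 * PI) * ((INR (S m) + k) * kernel_J k x y (S m) * r ^ S m)).
Proof.
intros hk hE hr hx hy; unfold Pterm.
replace (Z.abs (- Z.of_nat (S m))) with (Z.of_nat (S m)) by lia.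
replace (Z.abs (Z.of_nat (S m))) with (Z.of_nat (S m)) by lia.
rewrite <- INR_IZR_INZ, rpow_add_nat by easy.
pose proof (E_kernel k E m x y hk hE hx hy) as h; cbv zeta in h.
rewrite !RtoC_mult in *.
set (M := Z.of_nat (S m)) in *.
transitivity (RtoC (r ^ S m) * RtoC (rpow r k) *
  (RtoC (gam k (E M) M) * (Efun (E M) M x * Efun (E M) M (- y))
   + RtoC (gam k (E (- M)%Z) (- M))
     * (Efun (E (- M)%Z) (- M) x * Efun (E (- M)%Z) (- M) (- y))))%C; [ring |].
rewrite h, <- !RtoC_mult; f_equal.
(* The factors (m + 1) + k and m + (k + 1) of the two inverse norms agree, so the even and odd parts
   combine into [kernel_J]. *)
unfold Rdiv; rewrite !gnorm_inv by lra; unfold kernel_J; rewrite S_INR.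
pose proof PI_RGT_0; field; lra.
Qed.

Lemma Pterm_0 (k : R) (E : Z -> Z -> C) (r x y : R) :
  0 < k -> 0 <= r ->
  Pterm k E r x y 0
  = RtoC (rpow r k / (2 * PI) * ((INR 0 + k) * kernel_J k x y 0 * r ^ 0)).
Proof.
intros hk hr.
assert (e : forall t, Efun (E 0%Z) 0 t = RtoC 1).
{ intros t; unfold Efun; simpl; rewrite sum_n_n; unfold Ecoef, cexpi; simpl.
  rewrite Rmult_0_l, cos_0, sin_0; apply Cmult_1_l. }
unfold Pterm; rewrite !e; unfold gam.
rewrite (normsq_Lam k _ _ (fun x => geg k 0 (cos x) ^ 2)).
2: { intros t _; rewrite e, Cmod_sq, geg_0; simpl; ring. }
change (Lam k (fun x => geg k 0 (cos x) ^ 2)) with (gnorm k 0).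
rewrite gnorm_inv, Cmult_1_l, Cmult_1_r by easy; f_equal.
unfold kernel_J; rewrite !geg_0; simpl; rewrite Rplus_0_l.
pose proof PI_RGT_0; field; lra.
Qed.

Lemma Psum_S (k : R) (E : Z -> Z -> C) (r x y : R) (N : nat) :
  Psum k E r x y (S N) =
  (Psum k E r x y N
   + (Pterm k E r x y (Z.of_nat (S N)) + Pterm k E r x y (- Z.of_nat (S N))))%C.
Proof.
set (F := Pterm k E r x y).
assert (h : sum_n_m (fun m : nat => F (Z.of_nat m - Z.of_nat (S N))%Z) 1 (S (2 * N))
            = sum_n_m (fun m : nat => F (Z.of_nat m - Z.of_nat N)%Z) 0 (2 * N)).
{ rewrite <- sum_n_m_S; apply sum_n_m_ext; intros m; f_equal; lia. }
unfold Psum; fold F.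
replace (2 * S N)%nat with (S (S (2 * N))) by lia.
rewrite sum_Sn_m, sum_n_Sm, h by lia.
replace (Z.of_nat 0 - Z.of_nat (S N))%Z with (- Z.of_nat (S N))%Z by lia.
replace (Z.of_nat (S (S (2 * N))) - Z.of_nat (S N))%Z with (Z.of_nat (S N)) by lia.
set (s := sum_n_m _ _ _).
change ((F (- Z.of_nat (S N))%Z + (s + F (Z.of_nat (S N))))%C
        = (s + (F (Z.of_nat (S N)) + F (- Z.of_nat (S N))%Z))%C).
ring.
Qed.

Lemma Psum_kernel (k : R) (E : Z -> Z -> C) (r x y : R) (N : nat) :
  0 < k -> (forall n, IsHO k n (E n)) -> 0 <= r ->
  - PI <= x <= PI -> - PI <= y <= PI ->
  Psum k E r x y N
  = RtoC (rpow r k / (2 * PI)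
          * sum_f_R0 (fun n => (INR n + k) * kernel_J k x y n * r ^ n) N).
Proof.
intros hk hE hr hx hy; induction N as [|N IH].
- unfold Psum; simpl (2 * 0)%nat; rewrite sum_n_n; now apply Pterm_0.
- rewrite Psum_S, IH, Pterm_pair, <- RtoC_plus, tech5 by easy; f_equal; ring.
Qed.

Lemma isJ_hsum (k r x y : R) (N : nat) :
  0 < k ->
  isJ k (fun u => (1 + u) * hsum k (arg_cos x y u) N r)
    (sum_f_R0 (fun n => (INR n + k) * kernel_J k x y n * r ^ n) N).
Proof.
intros hk; induction N as [|N IH].
- unfold hsum; cbn [sum_f_R0].
  replace ((INR 0 + k) * kernel_J k x y 0 * r ^ 0)
    with ((INR 0 + k) * r ^ 0 * kernel_J k x y 0) by ring.
  eapply isJ_ext; [| exact (isJ_scal _ _ _ _ (isJ_kernel k x y 0 hk))].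
  intros u _; simpl; ring.
- rewrite tech5.
  replace ((INR (S N) + k) * kernel_J k x y (S N) * r ^ S N)
    with ((INR (S N) + k) * r ^ S N * kernel_J k x y (S N)) by ring.
  eapply isJ_ext;
    [| exact (isJ_plus _ _ _ _ _ IH
         (isJ_scal _ _ _ _ (isJ_kernel k x y (S N) hk)))].
  intros u _; unfold hsum; rewrite tech5; ring.
Qed.

(** The value lies between cos(x + y) and cos(x - y). In squares, 2 - 2 (s t + u p q) is (s - t)^2
    plus half of (1 + u) (p - q)^2 + (1 - u) (p + q)^2, and similarly for the lower bound. *)
Lemma arg_cos_bound (x y u : R) : -1 <= u <= 1 -> -1 <= arg_cos x y u <= 1.
Proof.
intros hu; unfold arg_cos.
pose proof (sin_sq x) as hx; pose proof (sin_sq y) as hy.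
set (s := cos x) in *; set (t := cos y) in *.
set (p := sin x) in *; set (q := sin y) in *.
pose proof (Rle_0_sqr (s - t)); pose proof (Rle_0_sqr (s + t)).
pose proof (Rle_0_sqr (p - q)); pose proof (Rle_0_sqr (p + q)).
unfold Rsqr in *.
assert (0 <= (1 + u) * ((p - q) * (p - q))) by (apply Rmult_le_pos; lra).
assert (0 <= (1 - u) * ((p + q) * (p + q))) by (apply Rmult_le_pos; lra).
assert (0 <= (1 + u) * ((p + q) * (p + q))) by (apply Rmult_le_pos; lra).
assert (0 <= (1 - u) * ((p - q) * (p - q))) by (apply Rmult_le_pos; lra).
split; nra.
Qed.

(** Provides the margin beyond [-1, 1] that [isJ_ex] asks for. On [-1, 1] the denominator is at
    least (1 - r)^2; it is affine in u with slope at most 2 in absolute value, so a margin of (1 -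
    r)^2 / 4 costs at most half of it. *)
Lemma gen_den_arg_pos (r x y u : R) :
  0 <= r < 1 -> - (1 + (1 - r) ^ 2 / 4) < u < 1 + (1 - r) ^ 2 / 4 ->
  0 < gen_den r (arg_cos x y u).
Proof.
intros hr hu.
assert (hd : 0 < (1 - r) ^ 2) by nra.
(* v is the projection of u onto [-1, 1]. *)
assert (hv : exists v, -1 <= v <= 1 /\ Rabs (u - v) <= (1 - r) ^ 2 / 4).
{ destruct (Rle_dec u (-1)) as [h | h]; [exists (-1) |
    destruct (Rle_dec u 1) as [h' | h']; [exists u | exists 1]];
    (split; [lra | apply Rabs_le; lra]). }
destruct hv as [v [hv hw]].
pose proof (arg_cos_bound x y v hv) as hb.
pose proof (gen_den_bounds r r _ ltac:(lra) ltac:(lra) hb) as [hg _].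
replace (gen_den r (arg_cos x y u))
  with (gen_den r (arg_cos x y v) - 2 * (r * ((u - v) * (sin x * sin y))))
  by (unfold gen_den, arg_cos; ring).
assert (hs : Rabs (r * ((u - v) * (sin x * sin y))) <= 1 * ((1 - r) ^ 2 / 4 * (1 * 1))).
{ rewrite !Rabs_mult.
  repeat apply Rmult_le_compat; try apply Rabs_pos; try apply abs_sin_le_1;
    try easy.
  - repeat apply Rmult_le_pos; apply Rabs_pos.
  - rewrite Rabs_pos_eq; lra.
  - apply Rmult_le_pos; apply Rabs_pos. }
pose proof (Rle_abs (r * ((u - v) * (sin x * sin y)))); lra.
Qed.

Lemma isJ_poisson_ex (k r x y : R) :
  0 < k -> 0 <= r < 1 ->
  exists I, isJ k (fun u => (1 + u) / rpow (gen_den r (arg_cos x y u)) (k + 1)) I.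
Proof.
intros hk hr.
set (r0 := 1 + (1 - r) ^ 2 / 4).
assert (hr0 : 1 < r0) by (unfold r0; nra).
set (D := fun u => gen_den r (arg_cos x y u)).
assert (hD : forall u, - r0 < u < r0 -> 0 < D u)
  by (intros; now apply gen_den_arg_pos).
set (d := - 2 * r * (sin x * sin y)).
assert (dD : forall u, is_derive D u d).
{ intros u; unfold D, gen_den, arg_cos, d; auto_derive; [easy | ring]. }
assert (dR : forall b u, - r0 < u < r0 ->
  is_derive (fun v => rpow (D v) b) u (d * (b * rpow (D u) (b - 1)))).
{ intros b u hu; apply (is_derive_comp (V := R_NormedModule) (fun z => rpow z b) D).
  - now apply is_derive_rpow, hD.
  - apply dD. }
assert (cR : forall b u, - r0 < u < r0 -> continuous (fun v => rpow (D v) b) u).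
{ intros b u hu.
  apply (ex_derive_continuous (V := R_NormedModule) (fun v => rpow (D v) b)).
  eexists; now apply dR. }
destruct (isJ_ex k r0 (fun u => (1 + u) * rpow (D u) (- (k + 1)))
  (fun u => 1 * rpow (D u) (- (k + 1))
            + (1 + u) * (d * (- (k + 1) * rpow (D u) (- (k + 1) - 1)))) hk hr0)
  as [I hI].
- intros u hu.
  apply (is_derive_mult (fun u => 1 + u) (fun u => rpow (D u) (- (k + 1))) u).
  + auto_derive; [easy | ring].
  + now apply dR.
  + intros; apply Rmult_comm.
- intros u hu.
  assert (cm : forall f g : R -> R, continuous f u -> continuous g u ->
                 continuous (fun v => f v * g v) u)
    by (intros f g; apply (continuous_mult (K := R_AbsRing))).
  apply (continuous_plus (V := R_NormedModule)
    (fun v => 1 * rpow (D v) (- (k + 1)))).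
  + apply cm; [apply continuous_const | now apply cR].
  + apply cm; [apply (cont_plus (fun _ => 1)); solve_cont |].
    apply cm; [apply continuous_const |].
    apply cm; [apply continuous_const | now apply cR].
- exists I; eapply isJ_ext; [| exact hI].
  intros u hu; simpl; unfold Rdiv; f_equal.
  assert (h : 0 < D u) by (apply hD; lra).
  rewrite !rpow_gt0 by exact h; apply Rpower_Ropp.
Qed.

(** The sum is itself an integral of [hsum], so its distance to the limit is the integral of the
    uniform error of [hsum_approx]; the 2 in the bound majorises 1 + u, and [Bt k] is the total
    mass. *)
Theorem kernel_sum_lim (k r x y I : R) :
  0 < k -> 0 <= r < 1 ->
  isJ k (fun u => (1 + u) / rpow (gen_den r (arg_cos x y u)) (k + 1)) I ->
  is_lim_seq
    (sum_f_R0 (fun n => (INR n + k) * kernel_J k x y n * r ^ n))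
    (k * (1 - r ^ 2) * I).
Proof.
intros hk hr hI.
destruct (hsum_approx k r hk hr) as [K hK].
set (c := k * (1 - r ^ 2)).
set (S := sum_f_R0 (fun n => (INR n + k) * kernel_J k x y n * r ^ n)).
assert (hb : forall N, Rabs (S N - c * I) <= 2 * K * Bt k * geg_tail k r N).
{ intros N.
  pose proof (isJ_plus _ _ _ _ _ (isJ_hsum k r x y N hk)
                (isJ_scal _ (- c) _ _ hI)) as hJ.
  fold S in hJ.
  replace (S N - c * I) with (S N + - c * I) by ring.
  replace (2 * K * Bt k * geg_tail k r N)
    with (2 * (K * geg_tail k r N) * Bt k) by ring.
  refine (isJ_norm k _ (fun _ => 2 * (K * geg_tail k r N) * 1) _ _ _ hJ _).
  - intros u hu.
    pose proof (hK N (arg_cos x y u) (arg_cos_bound x y u ltac:(lra))) as h.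
    replace ((1 + u) * hsum k (arg_cos x y u) N r
             + - c * ((1 + u) / rpow (gen_den r (arg_cos x y u)) (k + 1)))
      with ((1 + u) * (hsum k (arg_cos x y u) N r
             - c / rpow (gen_den r (arg_cos x y u)) (k + 1)))
      by (unfold Rdiv; ring).
    rewrite Rabs_mult, Rabs_pos_eq, Rmult_1_r by lra.
    apply Rmult_le_compat; [lra | apply Rabs_pos | lra | exact h].
  - now apply (isJ_scal _ _ (fun _ => 1)), isJ_1. }
assert (hlim : is_lim_seq (fun N => 2 * K * Bt k * geg_tail k r N) 0).
{ replace (Finite 0) with (Rbar_mult (2 * K * Bt k) 0)
    by (simpl; f_equal; ring).
  now apply (is_lim_seq_scal_l (geg_tail k r)), geg_tail_lim. }
assert (h0 : is_lim_seq (fun N => S N - c * I) 0).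
{ apply is_lim_seq_abs_0.
  apply (is_lim_seq_le_le (fun _ => 0) _ _ 0
           (fun N => conj (Rabs_pos _) (hb N)));
    [apply is_lim_seq_const | exact hlim]. }
apply (is_lim_seq_ext (fun N => (S N - c * I) + c * I)); [intros; ring |].
replace (Finite (c * I)) with (Finite (0 + c * I)) by (f_equal; ring).
apply is_lim_seq_plus'; [exact h0 | apply is_lim_seq_const].
Qed.

Lemma filterlim_RtoC (u : nat -> R) (l : R) :
  is_lim_seq u l ->
  filterlim (fun n => RtoC (u n)) eventually (locally (RtoC l)).
Proof.
intros h P [eps hP].
destruct (proj1 (filterlim_locally _ _) h eps) as [N hN].
exists N; intros n hn; apply hP; split; [now apply hN | apply ball_center].
Qed.

Theorem mainTheorem4 (k : R) (hk : 0 < k) (E : Z -> Z -> C)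
  (hE : forall n : Z, IsHO k n (E n))
  (r x y : R) (hr : 0 <= r < 1) (hx : - PI <= x <= PI) (hy : - PI <= y <= PI) :
  exists I : R,
    is_RInt_gen (Pint k r x y) (at_right (-1)) (at_left 1) I /\
    filterlim (Psum k E r x y) eventually
      (locally (RtoC (k / (2 * PI) * (1 - r ^ 2) * rpow r k * I))).
Proof.
destruct (isJ_poisson_ex k r x y hk hr) as [I hI].
exists I; split.
- eapply is_RInt_gen_ends_ext; [| exact hI].
  intros u _; unfold Pint, gen_den, arg_cos.
  replace (u * sin x * sin y) with (u * (sin x * sin y)) by ring.
  unfold Rdiv; ring.
- pose proof (kernel_sum_lim k r x y I hk hr hI) as h.
  apply (is_lim_seq_scal_l _ (rpow r k / (2 * PI)) _) in h.
  replace (k / (2 * PI) * (1 - r ^ 2) * rpow r k * I)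
    with (rpow r k / (2 * PI) * (k * (1 - r ^ 2) * I))
    by (pose proof PI_RGT_0; field; lra).
  eapply filterlim_ext; [| exact (filterlim_RtoC _ _ h)].
  intros N; symmetry; now apply Psum_kernel.
Qed.
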